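(* Let $Q_j(u)=u^{\mathsf T}A_ju$ ($j=1,2$) be real quadratic forms on $\mathbb R^3$ such that the pair $(Q_1,Q_2)$ has simple generalized spectrum, and let $$\Sigma=\{(u,Q_1(u),Q_2(u)):u\in\mathbb R^3\}\subset\mathbb R^5.$$ Then, for every $\varepsilon>0$, there is a constant $C_\varepsilon$ depending only on $\varepsilon$ such that every finite $X\subset\Sigma$ satisfies $$E(X)\le C_\varepsilon|X|^{2+\varepsilon}.$$ Moreover the exponent $2$ is sharp: it cannot be replaced by any smaller number, i.e. for no $b<2$ is there a constant $C$ with $E(X)\le C|X|^{b}$ for all finite $X\subset\Sigma$.
   Context: For a finite subset $X$ of $\mathbb R^5$, $E(X)=\sum_t r_{X-X}(t)^2$ with $r_{X-X}(t)=\#\{(x,y)\in X^2:x-y=t\}$. Here $A_1,A_2$ are real symmetric $3\times3$ matrices. The pair $(Q_1,Q_2)$ has simple generalized spectrum if $A_1$ is positive definite and $A_1^{-1/2}A_2A_1^{-1/2}$ has three distinct eigenvalues. *)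

(* Defs.v *)
From HB Require Import structures.
From mathcomp Require Import all_boot all_order all_algebra.
From mathcomp Require Import finmap.
From mathcomp Require Import all_classical all_reals all_analysis.

Set Implicit Arguments.
Unset Strict Implicit.
Unset Printing Implicit Defensive.

Import Order.TTheory GRing.Theory Num.Theory.

Local Open Scope classical_set_scope.
Local Open Scope fset_scope.
Local Open Scope ring_scope.

Definition qform (R : realType) (n : nat) (A : 'M[R]_n) (u : 'cV[R]_n) : R :=
  (u^T *m A *m u) 0 0.

Definition posdefmx (R : realType) (n : nat) (A : 'M[R]_n) : Prop :=
  A^T = A /\ (forall u : 'cV[R]_n, u != 0 -> 0 < qform A u).

(* By the spectral theorem, a positive definite A has exactly one positive
   definite square root; the default 0 is only reached for other A. *)
Definition sqrtmx (R : realType) (n : nat) (A : 'M[R]_n) : 'M[R]_n :=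
  xget 0 [set S : 'M[R]_n | posdefmx S /\ S *m S = A].

Definition inv_sqrtmx (R : realType) (n : nat) (A : 'M[R]_n) : 'M[R]_n :=
  sqrtmx (invmx A).

Definition simple_generalized_spectrum (R : realType) (A1 A2 : 'M[R]_3) : Prop :=
  posdefmx A1 /\
  exists l : 'I_3 -> R, injective l /\
    forall i, eigenvalue (inv_sqrtmx A1 *m A2 *m inv_sqrtmx A1) (l i).

(* The column vector (u, Q_1(u), Q_2(u)); the dimension 3 + (1 + 1) computes
   to 5. *)
Definition graph_point (R : realType) (A1 A2 : 'M[R]_3) (u : 'cV[R]_3) :
    'cV[R]_5 :=
  col_mx u (col_mx (qform A1 u)%:M (qform A2 u)%:M : 'cV[R]_(1 + 1)).

Definition Sigma (R : realType) (A1 A2 : 'M[R]_3) : set 'cV[R]_5 :=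
  range (graph_point A1 A2).

Definition diff_repr (R : realType) (X : {fset 'cV[R]_5}) (t : 'cV[R]_5) : nat :=
  #|` [fset p in X `*` X | p.1 - p.2 == t] |.

(* The summand vanishes outside the finite set X - X, so this finitely
   supported sum over the whole space is the usual one. *)
Definition additive_energy (R : realType) (X : {fset 'cV[R]_5}) : nat :=
  \sum_(t \in [set: 'cV[R]_5]) (diff_repr X t ^ 2)%N.

(* Main.v *)
Require Import Defs.
From HB Require Import structures.
From mathcomp Require Import all_boot all_order all_algebra.
From mathcomp Require Import finmap.
From mathcomp Require Import all_classical all_reals all_analysis.
From mathcomp Require Import ring lra zify.

Set Implicit Arguments.
Unset Strict Implicit.
Unset Printing Implicit Defensive.

Import Order.TTheory GRing.Theory Num.Theory.

(** Write a point of the surface as (u, Q_1(u), Q_2(u)).  A solution of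
    x - y = z - w in such points projects to a parallelogram in R^3, with sides
    t = y - x and d = z - x; comparing the last two coordinates shows that t and
    d are orthogonal for both polar forms B_1 and B_2.  So the energy counts
    parallelograms with doubly orthogonal sides, and the bound proved is
    E(X) <= K N^2 (1 + log_2 N) with N = |X| and K an absolute constant.

    The spectral hypothesis enters through one fact: A_1 t and A_2 t are parallel
    only for t on three fixed lines, the generalized eigenlines
    ([generalized_eigenlines]).

    If t lies on an eigenline, B_1-orthogonality lets one recover t from the
    diagonal t + d, so two opposite vertices and the name of the eigenline
    determine the parallelogram: at most 4 N^2 of these, and as many with d on an
    eigenline ([card_quadruples_on_axis_fst]).

    If t lies on no eigenline, the vectors doubly orthogonal to t form a line
    ([biorth_line]) that does not contain t.  Three vertices x, y, z form a
    corner, and by symmetry one may suppose that the line xy carries at least as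
    many points of X as the line xz.  For a line l with n points, the corners
    with xy = l number at most n^3, because x and y determine the line xz and that
    line has at most n points; they also number at most N n, because y and z
    determine x.  The second bound is summed over the lines with n^2 >= 4N: these
    carry O(N) incidences, by Cauchy-Schwarz ([rich_incidences]).  The first is
    summed over the other lines, grouped by the size of n up to a factor 2: by the
    Szemeredi-Trotter theorem there are O(N^2 / k^3) lines with about k points,
    so each of the O(log N) groups contributes O(N^2) ([card_corners]).

    The incidence theorem lives in the plane, which is reached by a projection of
    R^3 that creates no new collinear triples among the given points
    ([generic_projection]).  It is derived from the crossing lemma, following
    Szekely: consecutive points on the lines are joined by edges, and two lines
    produce at most one crossing.  The linear bound on the edges of a plane
    straight-line graph, on which the crossing lemma rests, is proved by charging
    edges to vertices instead of by Euler's formula ([noncrossing_card]).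

    For the sharpness, the solutions with x = y and z = w already give
    E(X) >= N^2, and the surface is infinite. *)

(** * Segments in the plane *)

Section Planar.
Local Open Scope ring_scope.
Variables (R : realFieldType) (T : finType) (X Y : T -> R).
Hypothesis X_inj : injective X.
Implicit Types (a b c d v w : T) (e f : T * T) (S : {set T}) (E : {set T * T}).

Definition slope e : R := (Y e.2 - Y e.1) / (X e.2 - X e.1).
Definition intercept e : R := Y e.1 - slope e * X e.1.
Definition height e (x : R) : R := slope e * x + intercept e.

(** An edge is a pair of vertices with the left one first.  The crossing abscissa
    of two edges depends only on the lines that carry them, so the edges of two
    given lines can cross at one abscissa only. *)
Definition meet_abscissa e f : R :=
  - (intercept e - intercept f) / (slope e - slope f).

Definition crossing e f : bool :=
  [&& slope e != slope f,
      X e.1 < meet_abscissa e f < X e.2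
    & X f.1 < meet_abscissa e f < X f.2].

Lemma height_left e : height e (X e.1) = Y e.1.
Proof. by rewrite /height /intercept; ring. Qed.

Lemma height_right e : e.1 != e.2 -> height e (X e.2) = Y e.2.
Proof.
move=> ne; rewrite /height /intercept /slope; field.
by rewrite subr_eq0 eq_sym (inj_eq X_inj).
Qed.

(** The difference of the two heights is affine, so a change of sign between two
    common abscissas forces a zero strictly in between. *)
Lemma sign_change_crossing e f (x1 x2 : R) :
    X e.1 <= x1 <= X e.2 -> X f.1 <= x1 <= X f.2 ->
    X e.1 <= x2 <= X e.2 -> X f.1 <= x2 <= X f.2 ->
    height e x1 < height f x1 -> height f x2 < height e x2 ->
  crossing e f.
Proof.
rewrite /height => e1 f1 e2 f2 lt1 lt2; rewrite /crossing /meet_abscissa.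
set D := slope e - slope f; set K := intercept e - intercept f.
have D1 : D * x1 + K < 0 by rewrite /D /K; nra.
have D2 : 0 < D * x2 + K by rewrite /D /K; nra.
have ne : D != 0 by apply/eqP => D0; move: D1 D2; rewrite D0; lra.
rewrite -subr_eq0 ne /=.
set m := - K / D; have mE : D * m = - K by rewrite /m mulrC divfK.
have [Dgt|Dlt] : D > 0 \/ D < 0 by move: ne; rewrite neq_lt => /orP[]; tauto.
- have : x1 < m by rewrite -(ltr_pM2l Dgt) mE; lra.
  have : m < x2 by rewrite -(ltr_pM2l Dgt) mE; lra.
  by move=> ? ?; apply/andP; split; lra.
- have : m < x1 by rewrite -(ltr_nM2l Dlt) mE; lra.
  have : x2 < m by rewrite -(ltr_nM2l Dlt) mE; lra.
  by move=> ? ?; apply/andP; split; lra.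
Qed.

Lemma slope_lt_left e f (x0 x : R) : height e x0 = height f x0 -> x < x0 ->
  (slope e < slope f) = (height f x < height e x).
Proof.
rewrite /height => h lt; apply/idP/idP => ?; nra.
Qed.

Lemma slope_lt_right e f (x0 x : R) : height e x0 = height f x0 -> x0 < x ->
  (slope e < slope f) = (height e x < height f x).
Proof.
rewrite /height => h lt; apply/idP/idP => ?; nra.
Qed.

End Planar.

(** A relation that is total on A and injective bounds the size of A, without a
    function having to be constructed: this is how all charging arguments below
    are phrased. *)
Lemma card_le_rel (U V : finType) (A : {set U}) (B : {set V}) (r : U -> V -> bool) :
    (forall x, x \in A -> exists2 y, y \in B & r x y) ->
    (forall x x' y, x \in A -> x' \in A -> r x y -> r x' y -> x = x') ->
  (#|A| <= #|B|)%N.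
Proof.
move=> tot inj; have [->|[x0 x0A]] := finset.set_0Vmem A; first by rewrite cards0.
have [y0 y0B _] := tot _ x0A.
pose g x := odflt y0 [pick y in B | r x y].
have gP x : x \in A -> (g x \in B) && r x (g x).
  move=> xA; rewrite /g; case: pickP => [y /=|no] //.
  by have [y yB rxy] := tot _ xA; have := no y; rewrite /= yB rxy.
rewrite -(card_in_imset (f := g) (D := A)); last first.
  move=> x x' xA x'A eg; have /andP[_ r1] := gP _ xA; have /andP[_ r2] := gP _ x'A.
  by apply: (inj _ _ (g x)) => //; rewrite eg.
apply/subset_leq_card/fintype.subsetP => _ /finset.imsetP[x xA ->].
by have /andP[] := gP _ xA.
Qed.

(** * Plane straight-line graphs have linearly many edges *)

Section PlaneGraph.
Local Open Scope ring_scope.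
Variables (R : realFieldType) (T : finType) (X Y : T -> R).
Hypothesis X_inj : injective X.
Variables (S : {set T}) (E : {set T * T}).
Implicit Types (a b c d v w : T) (e f : T * T).
Local Notation slope := (slope X Y).
Local Notation height := (height X Y).
Local Notation crossing := (crossing X Y).

Hypothesis edge_vertices :
  forall e, e \in E -> [/\ e.1 \in S, e.2 \in S & X e.1 < X e.2].
Hypothesis edge_avoids : forall e v, e \in E -> v \in S ->
  X e.1 < X v < X e.2 -> height e (X v) != Y v.
Hypothesis edges_noncrossing :
  forall e f, e \in E -> f \in E -> ~~ crossing e f.

Lemma edge_neq a b : (a, b) \in E -> a != b.
Proof.
by case/edge_vertices => _ _ /= lt; apply: contraTneq lt => ->; rewrite ltxx.
Qed.

Lemma edge_lt a b : (a, b) \in E -> X a < X b.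
Proof. by case/edge_vertices. Qed.

Lemma edge_heightl a b : height (a, b) (X a) = Y a.
Proof. exact: (height_left X Y (a, b)). Qed.

Lemma edge_heightr a b : (a, b) \in E -> height (a, b) (X b) = Y b.
Proof. by move/edge_neq=> ne; apply: (height_right Y X_inj (e := (a, b))). Qed.

(** Edges contain no vertex in their interior, so a vertex on an edge and to the
    right of its left end is its right end. *)
Lemma edge_on a b v : (a, b) \in E -> v \in S -> X a < X v <= X b ->
  height (a, b) (X v) = Y v -> v = b.
Proof.
move=> abE vS /andP[av]; rewrite le_eqVlt => /orP[/eqP/X_inj //|vb] h.
by have := edge_avoids abE vS; rewrite /= av vb => /(_ isT); rewrite h eqxx.
Qed.

Lemma eq_slope_left a b b' : (a, b) \in E -> (a, b') \in E ->
  slope (a, b) = slope (a, b') -> b = b'.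
Proof.
move=> abE ab'E sE.
have hE x : height (a, b) x = height (a, b') x.
  have := edge_heightl a b; have := edge_heightl a b'.
  by rewrite /height sE; lra.
have [_ bS lb] := edge_vertices abE; have [_ bS' lb'] := edge_vertices ab'E.
have [le|lt] := leP (X b) (X b').
  by apply: (edge_on ab'E) => //; [rewrite lb le|rewrite -hE edge_heightr].
by apply/esym/(edge_on abE) => //; [rewrite lb' ltW|rewrite hE edge_heightr].
Qed.

Lemma eq_slope_right a a' b : (a, b) \in E -> (a', b) \in E ->
  slope (a, b) = slope (a', b) -> a = a'.
Proof.
move=> abE ab'E sE.
have hE x : height (a, b) x = height (a', b) x.
  have := edge_heightr abE; have := edge_heightr ab'E.
  by rewrite /height sE; lra.
have [aS _ lb] := edge_vertices abE; have [aS' _ lb'] := edge_vertices ab'E.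
have [lt|lt|/X_inj //] := ltgtP (X a) (X a').
  have := edge_avoids abE aS'; rewrite /= lt lb' => /(_ isT).
  by rewrite hE edge_heightl eqxx.
have := edge_avoids ab'E aS; rewrite /= lt lb => /(_ isT).
by rewrite -hE edge_heightl eqxx.
Qed.

(** The angular sector at [a] between two edges that go to the right and are
    consecutive in slope. *)
Definition wedge a b c : bool :=
  [&& (a, b) \in E, (a, c) \in E, slope (a, b) < slope (a, c) &
    [forall d, ((a, d) \in E) ==> (slope (a, b) < slope (a, d)) ==>
               (slope (a, c) <= slope (a, d))]].

Definition in_wedge a b c v : bool :=
  [&& v \in S, X a < X v, height (a, b) (X v) <= Y v
    & Y v <= height (a, c) (X v)].

(** The edge [(a, b)] will be charged to the vertex [w]; what makes this work is
    that the part of the sector left of [w] is free of vertices, so that an edge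
    inside it has to come from [a] or through one of the two bounding edges. *)
Definition first_in_wedge a b c w : bool :=
  [&& wedge a b c, in_wedge a b c w &
    [forall v, in_wedge a b c v ==> (X w <= X v)]].

(** The edges with no sector above them; there is at most one for each left
    end. *)
Definition is_top e : bool :=
  (e \in E) && [forall d, ((e.1, d) \in E) ==> (slope (e.1, d) <= slope e)].

Lemma card_top : (#|[set e in E | is_top e]| <= #|S|)%N.
Proof.
apply: (@card_le_rel _ _ _ _ (fun e v => e.1 == v)) => [e|].
  by rewrite inE => /andP[eE _]; exists e.1 => //; have [] := edge_vertices eE.
move=> [a b] [a' b'] v /=; rewrite !inE => /andP[abE /andP[_ /forallP tb]].
move=> /andP[ab'E /andP[_ /forallP tb']] /eqP av /eqP a'v.
move: abE ab'E tb tb'; rewrite av a'v /= => abE ab'E tb tb'.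
congr (_, _); apply: (eq_slope_left abE ab'E); apply/eqP.
by rewrite eq_le (implyP (tb b') ab'E) (implyP (tb' b) abE).
Qed.

Lemma nontop_wedge a b : (a, b) \in E -> ~~ is_top (a, b) ->
  exists c w, first_in_wedge a b c w.
Proof.
move=> abE; rewrite /is_top abE /= negb_forall => /existsP[d].
rewrite negb_imply -ltNge => /andP[adE lt].
pose P d := ((a, d) \in E) && (slope (a, b) < slope (a, d)).
have Pd : P d by rewrite /P adE.
case: (Order.TotalTheory.arg_minP (fun d => slope (a, d)) Pd) => c /andP[acE bc] cmin.
have wdg : wedge a b c.
  rewrite /wedge abE acE bc /=; apply/forallP => v; apply/implyP => avE.
  by apply/implyP => lv; apply: cmin; rewrite /P avE.
have [_ bS lb] := edge_vertices abE.
have inb : in_wedge a b c b.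
  rewrite /in_wedge bS lb (edge_heightr abE) lexx /= ltW //.
  rewrite -(edge_heightr abE) -(slope_lt_right (x0 := X a)) //.
  by rewrite !edge_heightl.
case: (Order.TotalTheory.arg_minP X inb) => w inw wmin.
exists c, w; rewrite /first_in_wedge wdg inw /=.
by apply/forallP => v; apply/implyP => /wmin.
Qed.

(** If the sector is charged to the right end [b] of its lower edge, that edge
    arrives at [b] above all others.  An edge [(a', b)] arriving above it would,
    just left of [b], lie inside the sector; to come from there it has either to
    start in the empty part of the sector or to cross the edge [(a, c)]. *)
Lemma wedge_end_low a a' b c : (a, b) \in E -> (a, c) \in E -> (a', b) \in E ->
    slope (a, b) < slope (a, c) -> X b <= X c ->
    (forall v, in_wedge a b c v -> X b <= X v) ->
  slope (a, b) <= slope (a', b).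
Proof.
move=> abE acE a'bE lt bc emp; rewrite leNgt; apply/negP => lt'.
have lab := edge_lt abE; have lac := edge_lt acE; have la'b := edge_lt a'bE.
have hb : height (a', b) (X b) < height (a, c) (X b).
  rewrite (edge_heightr a'bE) -(edge_heightr abE) -(slope_lt_right (x0 := X a)) //.
  by rewrite !edge_heightl.
apply: (elimN idP (edges_noncrossing a'bE acE)).
have meetb : height (a', b) (X b) = height (a, b) (X b).
  by rewrite (edge_heightr a'bE) (edge_heightr abE).
have [aa'|a'a|/X_inj aa'] := ltgtP (X a) (X a').
- apply: (sign_change_crossing (x1 := X b) (x2 := X a')) => //=; try lra.
  rewrite edge_heightl ltNge; apply/negP => le.
  have [aS' _ _] := edge_vertices a'bE.
  suff /emp : in_wedge a b c a' by lra.
  rewrite /in_wedge aS' aa' le andbT /= ltW // -(edge_heightl a' b).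
  by rewrite -(slope_lt_left meetb).
- apply: (sign_change_crossing (x1 := X b) (x2 := X a)) => //=; try lra.
  by rewrite edge_heightl -(edge_heightl a b) -(slope_lt_left meetb).
- by move: lt'; rewrite aa' ltxx.
Qed.

(** The mirror image of [wedge_end_low]: an edge arriving at [c] from below would
    start in the empty part of the sector or cross [(a, b)]. *)
Lemma wedge_end_high a a' b c : (a, b) \in E -> (a, c) \in E -> (a', c) \in E ->
    slope (a, b) < slope (a, c) -> X c <= X b ->
    (forall v, in_wedge a b c v -> X c <= X v) ->
  slope (a', c) <= slope (a, c).
Proof.
move=> abE acE a'cE lt cb emp; rewrite leNgt; apply/negP => lt'.
have lab := edge_lt abE; have lac := edge_lt acE; have la'c := edge_lt a'cE.
have hc : height (a, b) (X c) < height (a', c) (X c).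
  rewrite (edge_heightr a'cE) -(edge_heightr acE) -(slope_lt_right (x0 := X a)) //.
  by rewrite !edge_heightl.
apply: (elimN idP (edges_noncrossing abE a'cE)).
have meetc : height (a, c) (X c) = height (a', c) (X c).
  by rewrite (edge_heightr a'cE) (edge_heightr acE).
have [aa'|a'a|/X_inj aa'] := ltgtP (X a) (X a').
- apply: (sign_change_crossing (x1 := X c) (x2 := X a')) => //=; try lra.
  rewrite edge_heightl ltNge; apply/negP => le.
  have [aS' _ _] := edge_vertices a'cE.
  suff /emp : in_wedge a b c a' by lra.
  rewrite /in_wedge aS' aa' le /= ltW // -(edge_heightl a' c).
  by rewrite -(slope_lt_left meetc).
- apply: (sign_change_crossing (x1 := X c) (x2 := X a)) => //=; try lra.
  by rewrite edge_heightl -(edge_heightl a c) -(slope_lt_left meetc).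
- by move: lt'; rewrite aa' ltxx.
Qed.

(** The three ways a sector can meet its first vertex: at the end of its lower
    edge, at the end of its upper edge, or strictly between the two. *)
Definition ends_low e w := [exists c, first_in_wedge e.1 e.2 c w && (e.2 == w)].
Definition ends_high e w := [exists c, first_in_wedge e.1 e.2 c w && (c == w)].
Definition ends_inside e w := [exists c,
  [&& first_in_wedge e.1 e.2 c w,
      height e (X w) < Y w < height (e.1, c) (X w), X w < X e.2 & X w < X c]].

Lemma first_in_wedge_le a b c w : first_in_wedge a b c w ->
  X w <= X b /\ X w <= X c.
Proof.
case/and3P => /and4P[abE acE lt _] _ /forallP mn.
have hlt x : X a < x -> height (a, b) x < height (a, c) x.
  by move=> ax; rewrite -(slope_lt_right (x0 := X a)) // !edge_heightl.
have [_ bS lb] := edge_vertices abE; have [_ cS lc] := edge_vertices acE.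
split; apply: (implyP (mn _)).
  by rewrite /in_wedge bS lb -(edge_heightr abE) lexx /= ltW ?hlt.
by rewrite /in_wedge cS lc -(edge_heightr acE) lexx /= ltW ?hlt.
Qed.

Lemma first_in_wedge_cases e w : (exists c, first_in_wedge e.1 e.2 c w) ->
  [|| ends_low e w, ends_high e w | ends_inside e w].
Proof.
case: e => a b [c fw]; move: (fw) => /=.
have [wb wc] := first_in_wedge_le fw.
case/and3P => /and4P[abE acE lt _] /and4P[wS aw hb hc] mn.
have [eb|nwb] := eqVneq w b.
  by apply/orP; left; apply/existsP; exists c; rewrite /= eb eqxx andbT -{2}eb.
have [ec|nwc] := eqVneq w c.
  by apply/orP; right; apply/orP; left; apply/existsP; exists c; rewrite fw ec eqxx.
apply/orP; right; apply/orP; right; apply/existsP; exists c; rewrite /= fw /=.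
rewrite !lt_neqAle hb hc wb wc !(inj_eq X_inj) nwb nwc !andbT /=.
apply/andP; split; apply/eqP => h.
  by move/eqP: nwb; apply; apply: (edge_on abE) => //; rewrite aw.
by move/eqP: nwc; apply; apply: (edge_on acE) => //; rewrite aw.
Qed.


Lemma ends_low_inj e e' w : ends_low e w -> ends_low e' w -> e = e'.
Proof.
case: e => a b; case: e' => a' b'.
case/existsP => c /= /andP[fw /eqP bw]; case/existsP => c' /= /andP[fw' /eqP b'w].
move: fw fw'; rewrite -bw in b'w *; rewrite b'w => fw fw'.
have [_ bc] := first_in_wedge_le fw; have [_ bc'] := first_in_wedge_le fw'.
move: fw fw' => /and3P[/and4P[abE acE lt _] _ /forallP mn].
move=> /and3P[/and4P[a'bE a'c'E lt' _] _ /forallP mn'].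
congr (_, _); apply: (eq_slope_right abE a'bE); apply/eqP; rewrite eq_le.
apply/andP; split.
  by apply: (wedge_end_low abE acE) => // v; apply/implyP/mn.
by apply: (wedge_end_low a'bE a'c'E) => // v; apply/implyP/mn'.
Qed.

(** The sectors at one vertex are disjoint, so the upper edge determines the
    lower one. *)
Lemma wedge_low_inj a b b' c : wedge a b c -> wedge a b' c -> b = b'.
Proof.
move=> /and4P[abE acE lt /forallP nx] /and4P[ab'E _ lt' /forallP nx'].
apply: (eq_slope_left abE ab'E).
have [l|l|//] := ltgtP (slope (a, b)) (slope (a, b')).
  by have := implyP (implyP (nx b') ab'E) l; rewrite leNgt lt'.
by have := implyP (implyP (nx' b) abE) l; rewrite leNgt lt.
Qed.

Lemma ends_high_inj e e' w : ends_high e w -> ends_high e' w -> e = e'.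
Proof.
case: e => a b; case: e' => a' b'.
case/existsP => c /= /andP[fw /eqP cw]; case/existsP => c' /= /andP[fw' /eqP c'w].
move: fw fw'; rewrite -cw in c'w *; rewrite c'w => fw fw'.
have [cb _] := first_in_wedge_le fw; have [cb' _] := first_in_wedge_le fw'.
move: fw fw' => /and3P[wd _ /forallP mn] /and3P[wd' _ /forallP mn'].
have aa' : a = a'.
  move: (wd) (wd') => /and4P[abE acE lt _] /and4P[a'b'E a'cE lt' _].
  apply: (eq_slope_right acE a'cE); apply/eqP; rewrite eq_le.
  apply/andP; split.
    by apply: (wedge_end_high a'b'E a'cE) => // v; apply/implyP/mn'.
  by apply: (wedge_end_high abE acE) => // v; apply/implyP/mn.
by rewrite aa' in wd *; rewrite (wedge_low_inj wd wd').
Qed.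

(** Suppose [w] is the first vertex, strictly inside, of sectors with apexes [a]
    and [a'], the second one further right.  Then [a'] is outside the sector of
    [a], say above it; the lower edge at [a'] passes below [w], so on its way it
    crosses the upper edge at [a]. *)
Lemma ends_inside_left a b c a' b' c' w :
    first_in_wedge a b c w -> first_in_wedge a' b' c' w ->
    height (a, b) (X w) < Y w < height (a, c) (X w) -> X w < X b -> X w < X c ->
    height (a', b') (X w) < Y w < height (a', c') (X w) ->
    X w < X b' -> X w < X c' ->
  X a' <= X a.
Proof.
move=> /and3P[/and4P[abE acE lt _] /and4P[wS aw _ _] /forallP mn].
move=> /and3P[/and4P[a'b'E a'c'E lt' _] /and4P[_ a'w _ _] _].
move=> /andP[h1 h2] wb wc /andP[h1' h2'] wb' wc'.
rewrite leNgt; apply/negP => aa'.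
have [aS' _ _] := edge_vertices a'b'E.
have : ~~ in_wedge a b c a'.
  by apply/negP => /(implyP (mn _)); rewrite leNgt a'w.
rewrite /in_wedge aS' aa' /= negb_and -!ltNge => /orP[below|above].
  apply: (elimN idP (edges_noncrossing a'c'E abE)).
  apply: (sign_change_crossing (x1 := X a') (x2 := X w)) => //=; try lra.
  by rewrite edge_heightl.
apply: (elimN idP (edges_noncrossing acE a'b'E)).
apply: (sign_change_crossing (x1 := X a') (x2 := X w)) => //=; try lra.
by rewrite edge_heightl.
Qed.

Lemma ends_inside_inj e e' w : ends_inside e w -> ends_inside e' w -> e = e'.
Proof.
case: e => a b; case: e' => a' b'.
case/existsP => c /= /and4P[fw h wb wc].
case/existsP => c' /= /and4P[fw' h' wb' wc'].
have aa' : a = a'.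
  apply: X_inj; apply/eqP; rewrite eq_le.
  by rewrite (ends_inside_left fw fw') // (ends_inside_left fw' fw).
move: fw fw' h h' => /and3P[/and4P[abE acE lt /forallP nx] /and4P[_ aw _ _] _].
move=> /and3P[/and4P[ab'E ac'E lt' /forallP nx'] _ _] /andP[h1 h2] /andP[h1' h2'].
rewrite -aa' in ab'E ac'E lt' nx' h1' h2' *; congr (_, _).
apply: (eq_slope_left abE ab'E).
have hle d d' : slope (a, d) <= slope (a, d') ->
    height (a, d) (X w) <= height (a, d') (X w).
  move=> le; rewrite leNgt -(slope_lt_right (x0 := X a)) ?edge_heightl //.
  by rewrite -leNgt.
have [l|l|//] := ltgtP (slope (a, b)) (slope (a, b')).
  by have := hle _ _ (implyP (implyP (nx b') ab'E) l); lra.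
by have := hle _ _ (implyP (implyP (nx' b) abE) l); lra.
Qed.

Lemma card_charged (r : T * T -> T -> bool) :
    (forall e w, r e w -> exists c, first_in_wedge e.1 e.2 c w) ->
    (forall e e' w, r e w -> r e' w -> e = e') ->
  (#|[set e in E | [exists w, r e w]]| <= #|S|)%N.
Proof.
move=> rS inj; apply: (card_le_rel (r := r)) => [e|e e' w _ _]; last exact: inj.
rewrite inE => /andP[_ /existsP[w rew]]; exists w => //.
by have [c /and3P[_ /and4P[]]] := rS _ _ rew.
Qed.

(** Top edges, and the three kinds of charges, each contribute at most one edge
    for each vertex. *)
Lemma noncrossing_card : (#|E| <= 4 * #|S|)%N.
Proof.
pose charged r := [set e in E | [exists w : T, r e w]].
have sub : E \subset [set e in E | is_top e] :|: charged ends_low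
             :|: charged ends_high :|: charged ends_inside.
  apply/fintype.subsetP => -[a b] abE; rewrite !inE abE /=.
  have [//|nt /=] := boolP (is_top (a, b)).
  have [c [w fw]] := nontop_wedge abE nt.
  have := @first_in_wedge_cases (a, b) w (ex_intro _ c fw).
  case/or3P => h; apply/orP; [left; apply/orP; left|left; apply/orP; right|right];
    by apply/existsP; exists w.
have low : (#|charged ends_low| <= #|S|)%N.
  apply: card_charged ends_low_inj => e w /existsP[c /andP[]]; by exists c.
have high : (#|charged ends_high| <= #|S|)%N.
  apply: card_charged ends_high_inj => e w /existsP[c /andP[]]; by exists c.
have inside : (#|charged ends_inside| <= #|S|)%N.
  apply: card_charged ends_inside_inj => e w /existsP[c /and4P[]]; by exists c.
apply: leq_trans (subset_leq_card sub) _.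
have -> : (4 * #|S| = #|S| + #|S| + #|S| + #|S|)%N by ring.
apply: leq_trans (leq_card_setU _ _) (leq_add _ inside).
apply: leq_trans (leq_card_setU _ _) (leq_add _ high).
apply: leq_trans (leq_card_setU _ _) (leq_add _ low).
exact: card_top.
Qed.

End PlaneGraph.

(** * The crossing lemma *)

(** Colour the vertices independently with [m.+1] colours: a set of [k] vertices
    receives the colour 0 throughout with probability [m.+1 ^- k].  Stated without
    division, as a count of colourings. *)
Lemma card_zero_colorings (T : finType) (m : nat) (A : {set T}) :
  (#|[set f : {ffun T -> 'I_m.+1} | A \subset [set v | f v == ord0]]|
     * m.+1 ^ #|A| = m.+1 ^ #|T|)%N.
Proof.
pose F v := if v \in A then pred1 (ord0 : 'I_m.+1) else predT.
have -> : #|[set f : {ffun T -> 'I_m.+1} | A \subset [set v | f v == ord0]]|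
          = #|family F|.
  apply: eq_card => f; rewrite inE; apply/fintype.subsetP/familyP => h v; last first.
    by move=> vA; rewrite inE; have := h v; rewrite /F vA.
  by rewrite /F; case: ifP => // /h; rewrite inE.
rewrite card_family foldrE big_map big_enum /=.
have -> : (m.+1 ^ #|A| = \prod_(v : T) (if v \in A then m.+1 else 1))%N.
  by rewrite -big_mkcond prod_nat_const.
rewrite -big_split /= -prod_nat_const.
apply: eq_bigr => v _; rewrite /F; case: ifP => _; first by rewrite card1 mul1n.
by rewrite cardT size_enum_ord muln1.
Qed.

(** The expected number of members of a family of [k]-sets that survive in the
    colour class 0. *)
Lemma sum_card_sampled (T I : finType) (m : nat) (D : {set I}) (A : I -> {set T}) k :
    (forall i, i \in D -> #|A i| = k) ->
  ((\sum_(f : {ffun T -> 'I_m.+1})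
       #|[set i in D | A i \subset [set v | f v == ord0]]|) * m.+1 ^ k
    = #|D| * m.+1 ^ #|T|)%N.
Proof.
move=> Ak.
have -> : (\sum_(f : {ffun T -> 'I_m.+1})
       #|[set i in D | A i \subset [set v | f v == ord0]]|
   = \sum_(i in D) #|[set f : {ffun T -> 'I_m.+1} |
                         A i \subset [set v | f v == ord0]]|)%N.
  under [RHS]eq_bigr do rewrite -sum1_card big_mkcond /=.
  rewrite exchange_big /=; apply: eq_bigr => f _.
  rewrite -sum1_card big_mkcond [RHS]big_mkcond /=; apply: eq_bigr => i _.
  by rewrite !inE; case: (i \in D).
rewrite big_distrl /= -sum_nat_const; apply: eq_bigr => i iD.
by rewrite -(Ak i iD) card_zero_colorings.
Qed.

Section CrossingLemma.
Variables (R : realFieldType) (T : finType) (X Y : T -> R).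
Hypothesis X_inj : injective X.
Implicit Types (S : {set T}) (E F : {set T * T}).

Definition crossings E : {set (T * T) * (T * T)} :=
  [set p in finset.setX E E | crossing X Y p.1 p.2].

Definition straight_line_graph S E : Prop :=
  (forall e, e \in E -> [/\ e.1 \in S, e.2 \in S & (X e.1 < X e.2)%R]) /\
  (forall e v, e \in E -> v \in S ->
     (X e.1 < X v < X e.2)%R -> height X Y e (X v) != Y v).

(** Deleting an edge of a crossing pair destroys at least one crossing; repeat
    until the graph is plane. *)
Lemma crossings_lower_bound S E : straight_line_graph S E ->
  (#|E| <= 4 * #|S| + #|crossings E|)%N.
Proof.
have [n] := ubnP #|E|; elim: n => // n IHn in E *; rewrite ltnS => En [vert avoid].
have [nc|] := boolP [forall e in E, forall f in E, ~~ crossing X Y e f].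
  apply: leq_trans (leq_addr _ _); apply: (noncrossing_card X_inj vert avoid).
  by move=> e f eE fE; move/forall_inP/(_ e eE)/forall_inP/(_ f fE): nc.
rewrite negb_forall_in => /exists_inP[e eE]; rewrite negb_forall_in.
case/exists_inP => f fE; rewrite negbK => cr.
have lt : (#|E :\ e| < n)%N by move: En; rewrite (cardsD1 e E) eE.
have := IHn _ lt; rewrite (cardsD1 e E) eE => IH.
have sub : crossings (E :\ e) \subset crossings E :\ (e, f).
  apply/fintype.subsetP => -[e' f']; rewrite !inE /= xpair_eqE.
  by move=> /andP[/andP[/andP[/negPf -> ->] /andP[_ ->]] ->].
have efC : (e, f) \in crossings E by rewrite !inE /= eE fE.
have := subset_leq_card sub; rewrite (cardsD1 (e, f) (crossings E)) efC.
move: #|crossings E :\ (e, f)| => cr' le.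
have : straight_line_graph S (E :\ e).
  by split=> [g|g v]; rewrite finset.in_setD1 => /andP[_ gE]; [exact: vert|exact: avoid].
move/IH => {}IH; rewrite add1n addnS ltnS.
by apply: leq_trans IH _; rewrite leq_add2l.
Qed.

(** Edges with a common end meet there, so by uniqueness of the meeting point they
    do not cross in their interiors. *)
Lemma crossing_card4 E e f : straight_line_graph [set: T] E ->
    e \in E -> f \in E -> crossing X Y e f ->
  #|[set e.1; e.2; f.1; f.2]| = 4.
Proof.
move=> [vert _] eE fE.
have [_ _ lte] := vert _ eE; have [_ _ ltf] := vert _ fE.
have ne : e.1 != e.2 by apply: contraTneq lte => ->; rewrite ltxx.
have nf : f.1 != f.2 by apply: contraTneq ltf => ->; rewrite ltxx.
case/and3P; rewrite -subr_eq0 => sl.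
set m := meet_abscissa _ _ _ _ => /andP[em me] /andP[fm mf].
have hm : height X Y e m = height X Y f m.
  by rewrite /height /m /meet_abscissa; field.
have meet v : height X Y e (X v) = height X Y f (X v) -> X v = m.
  rewrite /height in hm *; move=> hv; apply: (mulfI sl); lra.
have n11 : e.1 != f.1.
  apply: contraTneq em => h; rewrite -(meet e.1) ?ltxx //.
  by rewrite height_left h height_left.
have n12 : e.1 != f.2.
  by apply: contraTneq em => h; rewrite h -leNgt ltW.
have n21 : e.2 != f.1.
  by apply: contraTneq me => h; rewrite h -leNgt ltW.
have n22 : e.2 != f.2.
  apply: contraTneq me => h; rewrite -(meet e.2) ?ltxx //.
  by rewrite (height_right _ X_inj ne) h (height_right _ X_inj nf).
have -> : [set e.1; e.2; f.1; f.2] = [set v in [:: e.1; e.2; f.1; f.2]].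
  by apply/finset.setP => v; rewrite !inE -!orbA.
rewrite cardsE; apply/(card_uniqP _).
by rewrite /= !inE !negb_or ne n11 n12 n21 n22 nf.
Qed.

(** The linear bound, applied to the colour class 0 of a random colouring with [m]
    colours and averaged: vertices survive with probability 1/m, edges with
    probability 1/m^2, crossings only with probability 1/m^4. *)
Lemma crossings_sampling E (m : nat) : straight_line_graph [set: T] E -> (0 < m)%N ->
  (#|E| * m ^ 2 <= 4 * #|T| * m ^ 3 + #|crossings E|)%N.
Proof.
case: m => // m Egr _; have [vert avoid] := Egr.
pose S (f : {ffun T -> 'I_m.+1}) := [set v | f v == ord0].
pose Ends (e : T * T) := [set e.1; e.2].
pose Ends2 (p : (T * T) * (T * T)) := [set p.1.1; p.1.2; p.2.1; p.2.2].
pose Ef f := [set e in E | Ends e \subset S f].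
have bound f : (#|Ef f| <= 4 * #|[set v in [set: T] | [set v] \subset S f]|
                   + #|[set p in crossings E | Ends2 p \subset S f]|)%N.
  have -> : [set v in [set: T] | [set v] \subset S f] = S f.
    by apply/finset.setP => v; rewrite !inE finset.sub1set inE.
  have gr : straight_line_graph (S f) (Ef f).
    split=> [e|e v]; rewrite inE => /andP[eE].
      by have [_ _ ?] := vert _ eE; rewrite finset.subUset !finset.sub1set => /andP[-> ->].
    by move=> _ _; apply: avoid.
  apply: leq_trans (crossings_lower_bound gr) _; rewrite leq_add2l.
  apply/subset_leq_card/fintype.subsetP => -[e e']; rewrite !inE /=.
  rewrite /Ends2 /= !finset.subUset !finset.sub1set.
  by move=> /andP[/andP[/andP[-> /andP[-> ->]] /andP[-> /andP[-> ->]]] ->].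
have sE := @sum_card_sampled T _ m E Ends 2.
have sV := @sum_card_sampled T _ m [set: T] (fun v => [set v]) 1.
have sC := @sum_card_sampled T _ m (crossings E) Ends2 4.
have {}sE := sE _; have {}sV := sV _; have {}sC := sC _.
have Pn : (0 < m.+1 ^ #|T|)%N by rewrite expn_gt0.
(* All terms are brought to the common factor m^4 times the number of colourings. *)
rewrite -(leq_pmul2r Pn) mulnDl -sC; last first.
  move=> [e f]; rewrite !inE /= => /andP[/andP[eE fE] cr].
  exact: (crossing_card4 Egr eE fE cr).
have -> : (4 * #|T| * m.+1 ^ 3 * m.+1 ^ #|T|
           = 4 * (#|[set: T]| * m.+1 ^ #|T|) * m.+1 ^ 3)%N.
  by rewrite cardsT; ring.
rewrite -sV => [|v _]; last by rewrite cards1.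
rewrite mulnAC -sE => [|e eE]; last first.
  have [_ _ lt] := vert _ eE; rewrite cards2 (_ : e.1 != e.2) //.
  by apply: contraTneq lt => ->; rewrite ltxx.
rewrite -mulnA -expnD.
have sumb : (\sum_f #|Ef f| <= \sum_f
    (4 * #|[set v in [set: T] | [set v] \subset S f]|
       + #|[set p in crossings E | Ends2 p \subset S f]|))%N.
  by apply: leq_sum => f _; apply: bound.
move: sumb; rewrite big_split -big_distrr /= => sumb.
have := leq_mul sumb (leqnn (m.+1 ^ 4)); rewrite mulnDl.
by rewrite -[(4 * (_ * _) * _)%N]mulnA -[(_ * m.+1 ^ 1 * _)%N]mulnA -expnD !mulnA.
Qed.

End CrossingLemma.

(** * The Szemeredi-Trotter theorem *)

Section Lines.
Variables (R : realFieldType) (T : finType) (X Y : T -> R).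
Hypothesis X_inj : injective X.
Implicit Types (a b c : T) (e f : T * T) (l : {set T}) (L : {set {set T}}).
Local Notation height := (height X Y).
Local Notation slope := (slope X Y).
Local Notation intercept := (intercept X Y).

(** All the points of the given finite set on the line through [a] and [b]. *)
Definition line a b : {set T} := [set c | Y c == height (a, b) (X c)].

Lemma line_left a b : a \in line a b.
Proof. by rewrite inE; apply/eqP/esym/(height_left X Y (a, b)). Qed.

Lemma line_right a b : a != b -> b \in line a b.
Proof. by move=> ne; rewrite inE (height_right Y X_inj (e := (a, b))). Qed.

Lemma mem_line a b c : a != b ->
  (c \in line a b) = ((Y c - Y a) * (X b - X a) == (Y b - Y a) * (X c - X a))%R.
Proof.
move=> ne; have d0 : (X b - X a != 0)%R by rewrite subr_eq0 eq_sym (inj_eq X_inj).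
rewrite inE -(inj_eq (mulIf d0)) /height /intercept /slope /= -subr_eq0 -[RHS]subr_eq0.
by congr (_ == 0)%R; field.
Qed.

Lemma slope_intercept_line a b a' b' : a' != b' -> a' \in line a b -> b' \in line a b ->
  slope (a', b') = slope (a, b) /\ intercept (a', b') = intercept (a, b).
Proof.
rewrite !inE => ne /eqP ha /eqP hb.
have sE : slope (a', b') = slope (a, b).
  rewrite {1}/slope /= ha hb /height; field.
  by rewrite subr_eq0 eq_sym (inj_eq X_inj).
split=> //; rewrite {1}/intercept /= sE ha /height /=; ring.
Qed.

Lemma line_eq a b a' b' : a' != b' -> a' \in line a b -> b' \in line a b ->
  line a' b' = line a b.
Proof.
move=> ne ha hb; have [sE iE] := slope_intercept_line ne ha hb.
by apply/finset.setP => c; rewrite !inE /height sE iE.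
Qed.

Definition is_line l : bool := [exists a, exists b, (a != b) && (l == line a b)].

Lemma is_lineP l a b : is_line l -> a \in l -> b \in l -> a != b -> l = line a b.
Proof.
by case/existsP => c /existsP[d /andP[_ /eqP->]] al bl ne; rewrite -(line_eq ne al bl).
Qed.

Lemma line_is_line a b : a != b -> is_line (line a b).
Proof. by move=> ne; apply/existsP; exists a; apply/existsP; exists b; rewrite ne /=. Qed.

(** The points of a line are joined only to their neighbours, so that no edge
    runs through a vertex. *)
Definition consecutive l e : bool :=
  [&& e.1 \in l, e.2 \in l, (X e.1 < X e.2)%R
    & [forall c in l, ~~ (X e.1 < X c < X e.2)%R]].

Definition edges_of L : {set T * T} := [set e | [exists l in L, consecutive l e]].

Lemma lt_neq a b : (X a < X b)%R -> a != b.
Proof. by move=> lt; apply: contraTneq lt => ->; rewrite ltxx. Qed.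

Lemma consecutive_line l e : is_line l -> consecutive l e -> l = line e.1 e.2.
Proof. by move=> ll /and4P[? ? /lt_neq ? _]; apply: is_lineP. Qed.

Lemma consecutive_unique l e f (x : R) : consecutive l e -> consecutive l f ->
  (X e.1 < x < X e.2)%R -> (X f.1 < x < X f.2)%R -> e = f.
Proof.
have half e' f' : consecutive l e' -> consecutive l f' ->
  (X e'.1 < x < X e'.2)%R -> (X f'.1 < x < X f'.2)%R ->
    (X f'.1 <= X e'.1)%R /\ (X e'.2 <= X f'.2)%R.
  move=> /and4P[_ _ _ /forall_inP no] /and4P[f1 f2 _ _] /andP[l1 r1] /andP[l2 r2].
  have := no _ f1; rewrite (lt_trans l2 r1) andbT -leNgt; split=> //.
  by have := no _ f2; rewrite (lt_trans l1 r2) -leNgt.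
case: e f => [a b] [c d] ce cf xe xf.
have [/= h1 h2] := half _ _ ce cf xe xf; have [/= h3 h4] := half _ _ cf ce xf xe.
by congr (_, _); apply: X_inj; apply/eqP; rewrite eq_le ?h1 ?h2 ?h3 ?h4.
Qed.

Lemma card_consecutive l : (#|l| <= #|[set e | consecutive l e]|.+1)%N.
Proof.
have [->|[v vl]] := finset.set_0Vmem l; first by rewrite cards0.
case: (Order.TotalTheory.arg_minP X vl) => a al amin; have {}al : a \in l by [].
have {}amin b : b \in l -> (X a <= X b)%R by apply: amin.
rewrite (cardsD1 a l) al add1n ltnS.
apply: (card_le_rel (r := fun b e => e.2 == b)) => [b|b b' e _ _ /eqP<- /eqP//].
rewrite !inE => /andP[ne bl].
have ab : (a \in l) && (X a < X b)%R.
  by rewrite al lt_neqAle amin // andbT (inj_eq X_inj) eq_sym.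
case: (Order.TotalTheory.arg_maxP X ab (P := fun c => (c \in l) && (X c < X b)%R)).
move=> c /andP[cl cb] cmax; exists (c, b) => //; rewrite inE /consecutive cl bl cb /=.
apply/forall_inP => d dl; apply/negP => /andP[cd db].
have : (X d <= X c)%R by apply: cmax; rewrite dl db.
by rewrite leNgt cd.
Qed.

Section LineSet.
Variable L : {set {set T}}.
Hypothesis L_lines : forall l, l \in L -> is_line l.

Lemma edges_of_graph : straight_line_graph X Y [set: T] (edges_of L).
Proof.
split=> [e|e v]; rewrite inE => /exists_inP[l lL ce]; have /and4P[e1 e2 lt no] := ce.
  by rewrite !inE.
move=> _ btw; apply: contraTneq btw => h.
have vl : v \in l.
  by rewrite (consecutive_line (L_lines lL) ce) inE; apply/eqP; rewrite -h; case: (e).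
by move/forall_inP: no => /(_ _ vl).
Qed.

(** An edge lies on one line only, so the lines do not share edges. *)
Lemma card_edges_of : (\sum_(l in L) #|[set e | consecutive l e]| <= #|edges_of L|)%N.
Proof.
have -> : (\sum_(l in L) #|[set e | consecutive l e]|
           = \sum_e #|[set l in L | consecutive l e]|)%N.
  under eq_bigr do rewrite -sum1_card big_mkcond /=.
  rewrite exchange_big /=; apply: eq_bigr => e _.
  rewrite -sum1_card big_mkcond [RHS]big_mkcond /=; apply: eq_bigr => l _.
  by rewrite !inE; case: (l \in L).
rewrite -[#|edges_of L|]sum1_card [leqRHS]big_mkcond /=; apply: leq_sum => e _.
rewrite inE; case: ifP => [_|/negbT].
  apply/card_le1_eqP => l l'; rewrite !inE => /andP[lL ce] /andP[lL' ce'].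
  by rewrite (consecutive_line (L_lines lL) ce) (consecutive_line (L_lines lL') ce').
rewrite negb_exists_in => /forall_inP no; rewrite leqn0 cards_eq0.
apply/eqP/finset.setP => l; rewrite !inE; apply/negP => /andP[/no/negP]; exact.
Qed.

(** Two lines meet at one abscissa, and on each of them one pair of consecutive
    points encloses it: a crossing is determined by the two lines. *)
Lemma card_crossings_of_lines : (#|crossings X Y (edges_of L)| <= #|L| ^ 2)%N.
Proof.
rewrite -mulnn -finset.cardsX.
pose r (p : (T * T) * (T * T)) (q : {set T} * {set T}) :=
  [&& p \in crossings X Y (edges_of L), q \in finset.setX L L,
      consecutive q.1 p.1 & consecutive q.2 p.2].
apply: (card_le_rel (r := r)) => [[e f]|[e f] [e' f'] [l l'] _ _].
  move=> pC; have := pC; rewrite !inE /= => /andP[/andP[/exists_inP[l lL ce]]].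
  move=> /exists_inP[l' lL' cf] cr.
  exists (l, l'); first by rewrite !inE /= lL.
  by rewrite /r pC /= ce cf ?inE /= ?lL ?lL'.
rewrite /r; move=> /and4P[]; rewrite !inE /= => /andP[_ cr] /andP[lL lL'] ce cf.
move=> /and4P[/andP[_ cr'] _ ce' cf'].
have same g h l0 : l0 \in L -> consecutive l0 g -> consecutive l0 h ->
    slope g = slope h /\ intercept g = intercept h.
  move=> l0L cg ch; have := consecutive_line (L_lines l0L) ch.
  case/and4P: cg => g1 g2 /lt_neq ne _.
  case: g g1 g2 ne => [a b] /= g1 g2 ne l0E.
  rewrite l0E in g1 g2; have := slope_intercept_line ne g1 g2; by case: (h).
have [se ie] := same _ _ _ lL ce ce'; have [sf jf] := same _ _ _ lL' cf cf'.
have mE : meet_abscissa X Y e f = meet_abscissa X Y e' f'.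
  by rewrite /meet_abscissa se ie sf jf.
move: cr cr' => /and3P[_ me mf] /and3P[_ me' mf']; rewrite -mE in me' mf'.
by rewrite (consecutive_unique ce ce' me me') (consecutive_unique cf cf' mf mf').
Qed.

(** The hypothesis [k ^ 2 <= 4 * #|T|] selects the range where [#|T| ^ 2 / k ^ 3]
    is the dominant term. *)
Lemma szemeredi_trotter (k : nat) : (2 <= k)%N -> (k ^ 2 <= 4 * #|T|)%N ->
    (forall l, l \in L -> k <= #|l|)%N ->
  (#|L| * k ^ 3 <= 4096 * #|T| ^ 2)%N.
Proof.
move=> k2 kT rich.
have e_ge : (#|L| * k <= 2 * #|edges_of L|)%N.
  apply: leq_trans (leq_mul (leqnn 2) card_edges_of).
  rewrite -sum_nat_const big_distrr /=; apply: leq_sum => l /rich lk.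
  have := card_consecutive l; move: lk; move: #|l| => a; set b := #|_|; lia.
have cross := crossings_sampling X_inj edges_of_graph.
have crL := card_crossings_of_lines.
move: #|edges_of L| #|crossings X Y (edges_of L)| cross crL e_ge => e cr cross crL e_ge.
move: #|L| #|T| kT crL e_ge cross => Ln n kT crL e_ge cross {rich}.
have n0 : (0 < n)%N by case: n kT {cross} => //; rewrite muln0 leqn0 expn_eq0; lia.
(* The number of colours is e / 8n, so that 4 n m^3 is at most half of e m^2.
   If it vanishes, the graph is sparse and the bound on k^2 gives the result. *)
have [m0|m_gt0] := posnP (e %/ (8 * n))%N.
  have e_lt : (e < 8 * n)%N.
    by rewrite -(mul1n (8 * n)%N) -ltn_divLR ?muln_gt0 ?n0 // m0.
  have : (Ln * k * k ^ 2 <= 16 * n * (4 * n))%N by apply: leq_mul => //; lia.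
  rewrite -!mulnA -!expnS => h; apply: leq_trans h _; nia.
set m := (e %/ (8 * n))%N in m_gt0.
have m1 : (m * (8 * n) <= e)%N by apply: leq_trunc_div.
have m2 : (e <= 16 * n * m)%N.
  have : (e < m.+1 * (8 * n))%N by rewrite -ltn_divLR ?muln_gt0.
  by nia.
have half : (e * m ^ 2 <= 2 * Ln ^ 2)%N.
  have := cross _ m_gt0.
  have : (8 * n * m ^ 3 <= e * m ^ 2)%N.
    by have := leq_mul m1 (leqnn (m ^ 2)); rewrite !expnS; nia.
  have -> : (4 * n * m ^ 3 = (4 * (n * m ^ 3)))%N by ring.
  have -> : (8 * n * m ^ 3 = (8 * (n * m ^ 3)))%N by ring.
  lia.
have cube : (e ^ 3 <= 512 * n ^ 2 * Ln ^ 2)%N.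
  have s1 : (e ^ 2 <= (16 * n * m) ^ 2)%N by rewrite leq_sqr.
  have := leq_mul (leqnn e) s1; rewrite -expnS => h; apply: leq_trans h _.
  have := leq_mul (leqnn (256 * n ^ 2)%N) half.
  have -> : (e * (16 * n * m) ^ 2 = 256 * n ^ 2 * (e * m ^ 2))%N by ring.
  have -> : (512 * n ^ 2 * Ln ^ 2 = 256 * n ^ 2 * (2 * Ln ^ 2))%N by ring.
  by [].
have [->|L0] := posnP Ln; first by rewrite mul0n.
have Lpos : (0 < Ln ^ 2)%N by rewrite expn_gt0 L0.
rewrite -(leq_pmul2r Lpos).
have h : ((Ln * k) ^ 3 <= (2 * e) ^ 3)%N by rewrite leq_exp2r.
have := leq_mul (leqnn 8) cube.
have -> : (Ln * k ^ 3 * Ln ^ 2 = (Ln * k) ^ 3)%N by ring.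
have -> : (4096 * n ^ 2 * Ln ^ 2 = 8 * (512 * n ^ 2 * Ln ^ 2))%N by ring.
apply: leq_trans; apply: leq_trans h _.
by rewrite expnMn.
Qed.

End LineSet.
End Lines.

(** * Counting corners *)

Lemma sum_sqr_bound (T : finType) (a : T -> nat) :
  ((\sum_p a p) ^ 2 <= #|T| * \sum_p a p ^ 2)%N.
Proof.
rewrite -(leq_pmul2l (isT : (0 < 2)%N)).
have -> : (2 * (\sum_p a p) ^ 2 = \sum_p \sum_q 2 * (a p * a q))%N.
  rewrite -mulnn big_distrl big_distrr /=; apply: eq_bigr => p _.
  by rewrite big_distrr big_distrr.
have -> : (2 * (#|T| * \sum_p a p ^ 2) = \sum_p \sum_q (a p ^ 2 + a q ^ 2))%N.
  under [RHS]eq_bigr do rewrite big_split sum_nat_const /=.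
  by rewrite big_split /= sum_nat_const -big_distrr /= mul2n addnn.
by apply: leq_sum => p _; apply: leq_sum => q _; apply: nat_Cauchy.
Qed.

Section Corners.
Variables (R : realFieldType) (T : finType) (X Y : T -> R).
Hypothesis X_inj : injective X.
Implicit Types (x y z : T) (l : {set T}) (L : {set {set T}}).
Local Notation line := (line X Y).
Local Notation is_line := (is_line X Y).
Local Notation N := #|T|.

Lemma card_line_meet l l' : is_line l -> is_line l' -> l != l' -> (#|l :&: l'| <= 1)%N.
Proof.
move=> ll ll' ne; apply/card_le1_eqP => x y; rewrite !inE => /andP[xl xl'] /andP[yl yl'].
apply: contraNeq ne => ne.
by rewrite (is_lineP X_inj ll xl yl) 1?(is_lineP X_inj ll' xl' yl') // eq_sym.
Qed.

(** Let I be the number of incidences.  Cauchy-Schwarz on the degrees of the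
    points, with two lines meeting at most once, gives I^2 <= N (|L|^2 + I);
    richness gives I >= 2 sqrt N |L|, which absorbs the term N |L|^2. *)
Lemma rich_incidences L : (forall l, l \in L -> is_line l) ->
    (forall l, l \in L -> 4 * N <= #|l| ^ 2)%N ->
  (\sum_(l in L) #|l| <= 2 * N)%N.
Proof.
move=> L_lines rich; set I := (\sum_(l in L) _)%N.
pose deg x := #|[set l in L | x \in l]|.
have swap (F : T -> nat) : (\sum_x deg x * F x = \sum_(l in L) \sum_(x in l) F x)%N.
  under [RHS]eq_bigr do rewrite big_mkcond /=.
  rewrite exchange_big /=; apply: eq_bigr => x _.
  rewrite /deg -sum_nat_const big_mkcond [RHS]big_mkcond /=; apply: eq_bigr => l _.
  by rewrite !inE; case: (l \in L).
have degI : (\sum_x deg x = I)%N.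
  under eq_bigr do rewrite -[deg _]muln1.
  by rewrite swap; apply: eq_bigr => l _; rewrite sum1_card.
have deg2 : (\sum_x deg x ^ 2 <= #|L| ^ 2 + I)%N.
  under eq_bigr do rewrite -mulnn.
  rewrite swap -mulnn -sum_nat_const -big_split /=; apply: leq_sum => l lL.
  have -> : (\sum_(x in l) deg x = \sum_(l' in L) #|l :&: l'|)%N.
    under [RHS]eq_bigr do rewrite -sum1_card big_mkcond /=.
    rewrite exchange_big /= big_mkcond /=; apply: eq_bigr => x _.
    case: ifP => xl; last by rewrite big1 // => l' _; rewrite inE xl.
    rewrite /deg -sum1_card big_mkcond [RHS]big_mkcond /=; apply: eq_bigr => l' _.
    by rewrite !inE xl; case: (l' \in L).
  apply: leq_trans (_ : \sum_(l' in L) (1 + if l' == l then #|l| else 0) <= _)%N.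
    apply: leq_sum => l' l'L; case: eqVneq => [_|ne].
      by rewrite add1n leqW // subset_leq_card // finset.subsetIl.
    by rewrite addn0 card_line_meet ?L_lines // eq_sym.
  rewrite big_split /= sum1_card -big_mkcondr leq_add2l.
  by rewrite (big_pred1 l) // => l' /=; case: eqVneq => [->|]; rewrite ?lL ?andbF.
have CS := sum_sqr_bound deg; rewrite degI in CS.
(* Expanding both squares, this holds term by term: (|l| |l'|)^2 >= (4N)^2. *)
have low : (4 * N * #|L| ^ 2 <= I ^ 2)%N.
  have -> : (I ^ 2 = \sum_(l in L) \sum_(l' in L) #|l| * #|l'|)%N.
    rewrite -mulnn /I big_distrl /=; apply: eq_bigr => l _; by rewrite big_distrr.
  have -> : (4 * N * #|L| ^ 2 = \sum_(l in L) \sum_(l' in L) 4 * N)%N.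
    by rewrite !sum_nat_const; ring.
  apply: leq_sum => l lL; apply: leq_sum => l' l'L.
  by rewrite -leq_sqr [leqRHS]expnMn -mulnn leq_mul ?rich.
have : (I ^ 2 <= N * (#|L| ^ 2 + I))%N by apply: leq_trans CS (leq_mul _ deg2).
by move: I N low {CS rich degI deg2 swap}; move: #|L| => m I n; nia.
Qed.

Variable corner : T -> T -> T -> bool.
Hypothesis corner_neq : forall x y z, corner x y z -> x != y /\ x != z.
Hypothesis cornerC : forall x y z, corner x y z -> corner x z y.
Hypothesis corner_line : forall x y z z',
  corner x y z -> corner x y z' -> z' \in line x z.
Hypothesis corner_foot : forall l x x' y y' z, is_line l ->
  x \in l -> y \in l -> x' \in l -> y' \in l ->
  corner x y z -> corner x' y' z -> x = x'.

(** Corners whose first leg spans a line with at least as many points as the line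
    of the second leg; the other corners are obtained by swapping the legs. *)
Definition long_corners : {set T * T * T} :=
  [set t | corner t.1.1 t.1.2 t.2 && (#|line t.1.1 t.2| <= #|line t.1.1 t.1.2|)%N].

Definition corners_on l : {set T * T * T} :=
  [set t in long_corners | line t.1.1 t.1.2 == l].

Lemma corners_onP l x y z : (x, y, z) \in corners_on l ->
  [/\ corner x y z, is_line l, x \in l, y \in l & (#|line x z| <= #|l|)%N].
Proof.
rewrite !inE /= => /andP[/andP[c le] /eqP <-]; have [ne _] := corner_neq c.
by rewrite c le line_left line_right // line_is_line.
Qed.

(** The line of the second leg depends only on the first leg, and it has no more
    points than [l]. *)
Lemma card_corners_on_cube l : (#|corners_on l| <= #|l| ^ 3)%N.
Proof.
have -> : (#|corners_on l| =
    \sum_(p in finset.setX l l) #|[set z | (p.1, p.2, z) \in corners_on l]|)%N.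
  rewrite -sum1_card (partition_big (fun t => t.1) (mem (finset.setX l l))) /=; last first.
    by move=> [[x y] z] /corners_onP[_ _ xl yl _]; rewrite !inE xl.
  apply: eq_bigr => -[x y] _; rewrite -sum1_card.
  rewrite (reindex (fun z => (x, y, z))) /=; last first.
    exists (fun t => t.2) => [//|[[x' y'] z]]; rewrite inE /= => /andP[_ /eqP[-> ->]] //.
  by apply: eq_bigl => z; rewrite inE eqxx andbT.
apply: leq_trans (_ : \sum_(p in finset.setX l l) #|l| <= _)%N; last first.
  by rewrite sum_nat_const finset.cardsX !expnS expn0 muln1 mulnA.
apply: leq_sum => -[x y] _ /=.
have [->|[z]] := finset.set_0Vmem [set z | (x, y, z) \in corners_on l].
  by rewrite cards0.
rewrite inE => /corners_onP[c _ _ _ le]; apply: leq_trans le.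
apply/subset_leq_card/fintype.subsetP => z'; rewrite inE => /corners_onP[c' _ _ _ _].
exact: corner_line c c'.
Qed.

(** The foot of a corner is determined by the line [l] of the first leg and the
    end of the second leg. *)
Lemma card_corners_on_linear l : (#|corners_on l| <= N * #|l|)%N.
Proof.
rewrite mulnC -cardsT -finset.cardsX.
apply: (card_le_rel (r := fun t p => [&& t.1.2 == p.1 & t.2 == p.2])).
  by move=> [[x y] z] /corners_onP[_ _ _ yl _]; exists (y, z); rewrite ?inE ?yl ?eqxx.
move=> [[x y] z] [[x' y'] z'] [y0 z0] /corners_onP[c ll xl yl _].
move=> /corners_onP[c' _ xl' yl' _] /= /andP[/eqP ey /eqP ez] /andP[/eqP ey' /eqP ez'].
by subst y0 z0 y' z'; rewrite (corner_foot ll xl yl xl' yl' c c').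
Qed.

Lemma sum_corners_rich :
  (\sum_(l | is_line l && (4 * N <= #|l| ^ 2)) #|corners_on l| <= 2 * N ^ 2)%N.
Proof.
pose L := [set l | is_line l && (4 * N <= #|l| ^ 2)%N].
apply: leq_trans (_ : \sum_(l in L) N * #|l| <= _)%N.
  under [X in (_ <= X)%N]eq_bigl do rewrite inE.
  by apply: leq_sum => l _; apply: card_corners_on_linear.
rewrite -big_distrr /=.
have -> : (2 * N ^ 2 = N * (2 * N))%N by ring.
rewrite leq_mul2l rich_incidences ?orbT // => l; by rewrite inE => /andP[].
Qed.

(** Each of the O(N^2 / 8^j) lines of this size carries O(8^j) corners. *)
Lemma sum_corners_level j :
  (\sum_(l | [&& is_line l, 2 <= #|l|, #|l| ^ 2 < 4 * N & trunc_log 2 #|l| == j])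
      #|corners_on l| <= 8 * 4096 * N ^ 2)%N.
Proof.
pose L := [set l | [&& is_line l, (2 <= #|l|)%N, (#|l| ^ 2 < 4 * N)%N
                    & trunc_log 2 #|l| == j]].
apply: leq_trans (_ : \sum_(l in L) 8 * (2 ^ j) ^ 3 <= _)%N.
  under [X in (_ <= X)%N]eq_bigl do rewrite inE.
  apply: leq_sum => l /and4P[_ l2 _ /eqP lj].
  apply: leq_trans (card_corners_on_cube l) _.
  have l0 : (0 < #|l|)%N by apply: leq_trans l2.
  have /andP[_ /ltnW] := trunc_log_bounds (isT : (1 < 2)%N) l0; rewrite lj => h.
  by rewrite -(expnMn 2 _ 3) -expnS leq_exp2r.
have [->|[l0]] := finset.set_0Vmem L; first by rewrite big_set0.
rewrite inE => /and4P[_ l2 l4 /eqP lj].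
have low l : (2 <= #|l|)%N -> trunc_log 2 #|l| = j -> (2 ^ j <= #|l|)%N.
  move=> ll <-; have ll0 : (0 < #|l|)%N by apply: leq_trans ll.
  by have /andP[] := trunc_log_bounds (isT : (1 < 2)%N) ll0.
have st : (#|L| * (2 ^ j) ^ 3 <= 4096 * N ^ 2)%N.
  apply: (szemeredi_trotter X_inj (Y := Y)).
  - by move=> l; rewrite inE => /and4P[].
  - rewrite -{1}(expn1 2) leq_exp2l // -lj.
    by rewrite -(trunc_expnK 1 (isT : (1 < 2)%N)) leq_trunc_log.
  - apply: leq_trans (ltnW l4); rewrite leq_sqr; exact: low.
  - by move=> l; rewrite inE => /and4P[_ ? _ /eqP]; apply: low.
rewrite sum_nat_const mulnCA -mulnA leq_mul2l; exact: st.
Qed.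

Lemma card_long_corners :
  (#|long_corners| <= 2 * N ^ 2 + (trunc_log 2 N).+1 * (8 * 4096 * N ^ 2))%N.
Proof.
have onl l : (0 < #|corners_on l|)%N -> is_line l && (2 <= #|l|)%N.
  rewrite card_gt0 => /finset.set0Pn[[[x y] z]] /corners_onP[c ll xl yl _].
  rewrite ll; have [ne _] := corner_neq c.
  by rewrite (cardsD1 x) xl (cardsD1 y) !inE yl eq_sym ne.
have -> : (#|long_corners| =
   \sum_(l | is_line l && (2 <= #|l|)%N) #|corners_on l|)%N.
  rewrite -sum1_card (partition_big (fun t => line t.1.1 t.1.2)
     (fun l => is_line l && (2 <= #|l|)%N)) /=; last first.
    move=> t tl; apply: onl; rewrite card_gt0; apply/finset.set0Pn; exists t.
    by rewrite inE tl eqxx.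
  by apply: eq_bigr => l _; rewrite -sum1_card; apply: eq_bigl => t; rewrite !inE.
rewrite (bigID (fun l => 4 * N <= #|l| ^ 2)%N) /=; apply: leq_add.
  apply: leq_trans sum_corners_rich; rewrite big_mkcond [leqRHS]big_mkcond.
  by apply: leq_sum => l _; case: (is_line l) => //=; case: (2 <= #|l|)%N => //=; case: ifP.
rewrite (partition_big (fun l => inord (trunc_log 2 #|l|) : 'I_(trunc_log 2 N).+1) predT) //=.
rewrite -[X in (_ <= X * _)%N]card_ord -sum_nat_const; apply: leq_sum => j _.
apply: leq_trans (sum_corners_level j); rewrite eq_leq //; apply: eq_bigl => l.
rewrite -ltnNge -!andbA; do 3 congr andb.
rewrite -val_eqE /= inordK // ltnS; apply: leq_trunc_log; exact: max_card.
Qed.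

Lemma card_corners :
  (#|[set t : T * T * T | corner t.1.1 t.1.2 t.2]|
     <= (4 + 16 * 4096) * N ^ 2 * (trunc_log 2 N).+1)%N.
Proof.
set C := [set t : T * T * T | _].
pose short := C :\: long_corners.
have : (#|short| <= #|long_corners|)%N.
  apply: (card_le_rel (r := fun t t' => t' == (t.1.1, t.2, t.1.2))).
    move=> [[x y] z]; rewrite !inE /= => /andP[nl c]; exists (x, z, y) => //.
    by rewrite !inE /= cornerC //=; move: nl; rewrite c /= -ltnNge => /ltnW.
  by move=> [[x y] z] [[x' y'] z'] t _ _ /= /eqP-> /eqP[-> -> ->].
have : (#|C| <= #|long_corners| + #|short|)%N.
  rewrite -[X in (X <= _)%N](cardsID long_corners) leq_add2r.
  by apply/subset_leq_card/finset.subsetIr.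
have := card_long_corners.
have -> : (16 * 4096 = 2 * (8 * 4096))%N by rewrite mulnA.
move: #|C| #|short| #|long_corners| (trunc_log 2 N) (N ^ 2)%N (8 * 4096)%N.
move=> c s b J n K; nia.
Qed.

End Corners.

(** * Pairs of quadratic forms with simple spectrum *)

Local Open Scope ring_scope.

Section SimpleEigenvalues.
Variables (F : fieldType) (n : nat).

(** With as many eigenvalues as dimensions, eigenspaces are lines, and there is no
    further eigenvalue. *)
Lemma simple_spectrum_eigenlines (g : 'M[F]_n.+1) (a : 'I_n.+1 -> F) :
    injective a -> (forall i, eigenvalue g (a i)) ->
  exists w : 'I_n.+1 -> 'rV[F]_n.+1, forall mu (y : 'rV[F]_n.+1),
    y *m g = mu *: y -> exists i c, y = c *: w i.
Proof.
move=> a_inj ev.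
have rank1 i : \rank (eigenspace g (a i)) = 1.
  have dir : mxdirect (\sum_i eigenspace g (a i)).
    by apply: mxdirect_sum_eigenspace => j k _ _; apply: a_inj.
  have pos j : (0 < \rank (eigenspace g (a j)))%N by rewrite lt0n mxrank_eq0; apply: ev.
  have := rank_leq_row (\sum_i eigenspace g (a i))%MS.
  rewrite (mxdirectP dir) /= (bigD1 i) //= => le.
  have ge : (n <= \sum_(j | j != i) \rank (eigenspace g (a j)))%N.
    apply: leq_trans (_ : \sum_(j | j != i) 1 <= _)%N; last exact: leq_sum.
    by rewrite sum1_card cardC1 card_ord.
  apply/eqP; rewrite eqn_leq pos andbT -(leq_add2r n) add1n.
  by apply: leq_trans le; rewrite leq_add2l.
have w_ex i : exists w, forall y : 'rV[F]_n.+1, y *m g = a i *: y -> exists c, y = c *: w.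
  have [w wg w0] := eigenvalueP (ev i); exists w => y /eigenspaceP yg.
  apply/sub_rVP; apply: submx_trans yg _.
  move/eigenspaceP: wg => wg.
  by rewrite -(geq_leqif (mxrank_leqif_sup wg)) rank1 lt0n mxrank_eq0.
have [w wP] := choice w_ex; exists w => mu y yg.
have [->|y0] := eqVneq y 0; first by exists ord0, 0; rewrite scale0r.
suff [i ai] : exists i, a i = mu by exists i; apply: wP; rewrite ai.
apply: contrapT => no.
have root_mu : root (char_poly g) mu.
  by rewrite -eigenvalue_root_char; apply/eigenvalueP; exists y.
have := max_poly_roots (p := char_poly g) (rs := mu :: [seq a i | i <- enum 'I_n.+1]).
rewrite size_char_poly /= size_map size_enum_ord ltnn monic_neq0 ?char_poly_monic //.
rewrite root_mu /= map_inj_uniq // enum_uniq andbT => abs.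
suff : false by []; apply: abs => //.
  by apply/allP => _ /mapP[i _ ->]; rewrite -eigenvalue_root_char.
by apply/negP => /mapP[i _ mE]; apply: no; exists i.
Qed.

End SimpleEigenvalues.

Section Forms.
Variables (R : realType).

Definition bilin n (A : 'M[R]_n) (u v : 'cV[R]_n) : R := (u^T *m A *m v) 0 0.

Lemma qformE n (A : 'M[R]_n) u : qform A u = bilin A u u.
Proof. by []. Qed.

Lemma bilinDl n (A : 'M[R]_n) u v w : bilin A (u + v) w = bilin A u w + bilin A v w.
Proof. by rewrite /bilin linearD /= !mulmxDl mxE. Qed.

Lemma bilinDr n (A : 'M[R]_n) u v w : bilin A u (v + w) = bilin A u v + bilin A u w.
Proof. by rewrite /bilin mulmxDr mxE. Qed.

Lemma bilinZl n (A : 'M[R]_n) a u v : bilin A (a *: u) v = a * bilin A u v.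
Proof. by rewrite /bilin linearZ /= -!scalemxAl mxE. Qed.

Lemma bilinZr n (A : 'M[R]_n) a u v : bilin A u (a *: v) = a * bilin A u v.
Proof. by rewrite /bilin -scalemxAr mxE. Qed.

Lemma bilinC n (A : 'M[R]_n) u v : A^T = A -> bilin A u v = bilin A v u.
Proof.
move=> Asym; rewrite /bilin -[in LHS](trmxK (u^T *m A *m v)) mxE !trmx_mul.
by rewrite trmxK Asym mulmxA.
Qed.

(** The second difference of a quadratic form is twice its polar form. *)
Lemma qform_parallelogram n (A : 'M[R]_n) (x y z w : 'cV[R]_n) : A^T = A ->
    x - y = z - w ->
  qform A x - qform A y - (qform A z - qform A w) = 2 * bilin A (y - x) (z - x).
Proof.
move=> Asym h; pose t := y - x; pose d := z - x.
have yE : y = x + t by rewrite /t addrC subrK.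
have zE : z = x + d by rewrite /d addrC subrK.
have wE : w = x + t + d.
  have -> : w = z - (x - y) by rewrite h opprB addrC subrK.
  by apply/matrixP => i j; rewrite /t /d !mxE; ring.
rewrite -/t -/d yE zE wE !qformE; move: t d {yE zE wE} => t d.
rewrite !(bilinDl, bilinDr) (bilinC t x Asym) (bilinC d x Asym) (bilinC d t Asym).
by ring.
Qed.

Lemma posdef_unit n (A : 'M[R]_n) : posdefmx A -> A \in unitmx.
Proof.
case=> _ pos; rewrite -row_free_unit -kermx_eq0; apply/rowV0P => u /sub_kermxP uA.
apply: contraTeq isT => u0; have := pos u^T; rewrite trmx_eq0 => /(_ u0).
by rewrite /qform trmxK uA mul0mx mxE ltxx.
Qed.

(** With S the square root of A1^-1, the equation A2 t = mu A1 t says that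
    t^T A1 S is a left eigenvector of S A2 S. *)
Lemma generalized_eigenlines (A1 A2 : 'M[R]_3) :
    A1^T = A1 -> A2^T = A2 -> simple_generalized_spectrum A1 A2 ->
  exists v : 'I_3 -> 'cV[R]_3, forall mu t,
    A2 *m t = mu *: (A1 *m t) -> exists i c, t = c *: v i.
Proof.
move=> A1s A2s [pos1 [l [l_inj ev]]].
have A1u := posdef_unit pos1.
set S := inv_sqrtmx A1 in ev.
have [Ssym SS] : S^T = S /\ S *m S = invmx A1.
  (* If the square root took its default value 0, the matrix S A2 S would vanish,
     and a zero matrix does not have distinct eigenvalues. *)
  have [[[Ss _] SS]//|S0] : (posdefmx S /\ S *m S = invmx A1) \/ S = 0.
    by rewrite /S /inv_sqrtmx /sqrtmx; case: xgetP => [? _|]; [left|right].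
  suff lE i : l i = 0 by have := l_inj 0 1; rewrite !lE => /(_ erefl).
  have /eigenvalueP[y] := ev i; rewrite S0 !mul0mx mulmx0 => /esym/eqP.
  by rewrite scaler_eq0 => /orP[/eqP//|->].
have [w wP] := simple_spectrum_eigenlines l_inj ev.
exists (fun i => (w i *m S)^T) => mu t tP.
have A1SS : A1 *m S *m S = 1%:M by rewrite -mulmxA SS mulmxV.
have [|i [c yE]] := wP mu (t^T *m (A1 *m S)).
  have -> : t^T *m (A1 *m S) *m (S *m A2 *m S) = t^T *m (A1 *m S *m S) *m A2 *m S.
    by rewrite !mulmxA.
  rewrite A1SS mulmx1 -[t^T *m A2]trmxK trmx_mul trmxK A2s tP linearZ /=.
  by rewrite trmx_mul A1s -scalemxAl mulmxA.
exists i, c; rewrite -[t]trmxK -[t^T]mulmx1 -A1SS mulmxA yE -scalemxAl.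
by rewrite linearZ.
Qed.

Section Biorthogonal.
Variables (A1 A2 : 'M[R]_3).
Hypothesis (A1sym : A1^T = A1) (A2sym : A2^T = A2).
Hypothesis A1pos : forall u : 'cV[R]_3, u != 0 -> 0 < qform A1 u.
Variable v : 'I_3 -> 'cV[R]_3.
Hypothesis eigenlines : forall mu t,
  A2 *m t = mu *: (A1 *m t) -> exists i c, t = c *: v i.

Definition biorth t d := bilin A1 t d = 0 /\ bilin A2 t d = 0.
(** In coordinates diagonalizing both forms, the lines spanned by the [v i] are
    the coordinate axes. *)
Definition on_axis t := exists i c, t = c *: v i.

Lemma biorthC t d : biorth t d -> biorth d t.
Proof. by rewrite /biorth !(bilinC d t). Qed.

Lemma bilin_self_eq0 t : bilin A1 t t = 0 -> t = 0.
Proof. by apply: contra_eq => /A1pos; rewrite lt0r => /andP[]. Qed.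

(** Off the axes A1 t and A2 t are linearly independent, so they impose two
    independent linear conditions on d, in dimension 3. *)
Lemma biorth_line t d d' : ~ on_axis t -> d != 0 -> biorth t d -> biorth t d' ->
  exists c, d' = c *: d.
Proof.
move=> gen d0 td td'.
pose M : 'M[R]_(3, 1 + 1) := row_mx (A1 *m t) (A2 *m t).
have inker e : biorth t e -> (e^T <= kermx M)%MS.
  case=> e1 e2; apply/sub_kermxP; rewrite mul_mx_row.
  have z A : A^T = A -> bilin A t e = 0 -> e^T *m (A *m t) = 0.
    move=> As h; apply/matrixP => i j; rewrite !ord1 mulmxA [RHS]mxE.
    by rewrite -[LHS]/(bilin A e t) bilinC.
  by rewrite !z // row_mx0.
have rk : \rank M = 2.
  apply/eqP; rewrite -mxrank_tr; change (row_free M^T).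
  rewrite -kermx_eq0; apply/rowV0P => r /sub_kermxP rM.
  have : M *m r^T = 0 by rewrite -[M]trmxK -trmx_mul rM trmx0.
  pose r' : 'rV[R]_(1 + 1) := r.
  rewrite -[r]/r' -(hsubmxK r') tr_row_mx mul_row_col.
  rewrite [lsubmx r']mx11_scalar [rsubmx r']mx11_scalar !tr_scalar_mx !mul_mx_scalar.
  set a := lsubmx _ _ _; set b := rsubmx _ _ _ => ab.
  have b0 : b = 0.
    apply: contrapT => /eqP b0; apply: gen; apply: (eigenlines (mu := - a / b)).
    apply: (scalerI b0); rewrite scalerA mulrC divfK // scaleNr.
    by apply/eqP; rewrite -subr_eq0 opprK addrC ab.
  move: ab; rewrite b0 scale0r addr0 => /eqP; rewrite scaler_eq0 => /orP[/eqP->|/eqP At].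
    by rewrite -scalemx1 scale0r row_mx0.
  exfalso; apply: gen; exists 0, 0; rewrite scale0r; apply: bilin_self_eq0.
  by rewrite /bilin -mulmxA At mulmx0 mxE.
have kd : (kermx M <= d^T)%MS.
  rewrite -(geq_leqif (mxrank_leqif_sup (inker _ td))) mxrank_ker rk.
  by rewrite lt0n mxrank_eq0 trmx_eq0.
have /sub_rVP[c cE] := submx_trans (inker _ td') kd.
by exists c; rewrite -[d']trmxK cE linearZ /= trmxK.
Qed.

(** On the line of [u] a vector is determined by its B_1-product with [u], and
    this product does not change when [d] is added. *)
Lemma axis_component_unique (u t t' d d' : 'cV[R]_3) a a' :
  t = a *: u -> t' = a' *: u -> t != 0 -> t' != 0 ->
  biorth t d -> biorth t' d' -> t + d = t' + d' -> t = t'.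
Proof.
move=> tE t'E t0 t'0 [td _] [t'd' _] sE.
have perp b e s : s = b *: u -> s != 0 -> bilin A1 s e = 0 -> bilin A1 u e = 0.
  move=> ->; rewrite scaler_eq0 negb_or => /andP[b0 _]; rewrite bilinZl => /eqP.
  by rewrite mulf_eq0 (negPf b0) => /eqP.
have ud := perp _ _ _ tE t0 td; have ud' := perp _ _ _ t'E t'0 t'd'.
have : bilin A1 u (t + d) = bilin A1 u (t' + d') by rewrite sE.
rewrite !bilinDr ud ud' !addr0 tE t'E !bilinZr => /mulIf -> //.
apply: contraNneq t0 => /bilin_self_eq0 u0; by rewrite tE u0 scaler0.
Qed.

(** The second leg fixes the foot: moving the foot along [t] by [c] changes the
    B_1-product of [t] with the leg by [c] times the nonzero B_1(t, t). *)
Lemma biorth_foot (t d d' : 'cV[R]_3) a c : t != 0 -> a != 0 ->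
  biorth t d -> biorth (a *: t) d' -> d = c *: t + d' -> c = 0.
Proof.
move=> t0 a0 [td _] [atd' _] dE; move: td atd'.
rewrite dE bilinDr bilinZr bilinZl => h /eqP; rewrite mulf_eq0 (negPf a0) => /eqP h'.
move: h; rewrite h' addr0 => /eqP; rewrite mulf_eq0 => /orP[/eqP//|/eqP/bilin_self_eq0 t00].
by rewrite t00 eqxx in t0.
Qed.

End Biorthogonal.
End Forms.

(** * A projection to the plane preserving collinearity and non-collinearity *)

Lemma common_nonroot (R : numFieldType) (I : finType) (p : I -> {poly R}) :
  exists s, forall i, p i != 0 -> ~~ root (p i) s.
Proof.
pose P := \prod_(i | p i != 0) p i.
have P0 : P != 0 by apply/prodf_neq0.
have [[s Ps]|no] := pselect (exists s, ~~ root P s).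
  exists s => i pi0; apply: contra Ps; rewrite /P (bigD1 i) //= rootM.
  by move=> ->.
exfalso; have := max_poly_roots (rs := [seq i%:R | i <- iota 0 (size P)]) P0.
rewrite size_map size_iota ltnn => abs; suff : false by []; apply: abs.
  apply/allP => _ /mapP[i _ ->]; apply: contrapT => /negP nr; apply: no; by exists i%:R.
rewrite map_inj_uniq ?iota_uniq // => i j /eqP; by rewrite eqr_nat => /eqP.
Qed.

Section Projection.
Variable R : realType.

Definition coord (v : 'cV[R]_3) (k : nat) : R := v (inord k) 0.

Lemma coord_eqP (v w : 'cV[R]_3) :
  coord v 0 = coord w 0 -> coord v 1 = coord w 1 -> coord v 2 = coord w 2 -> v = w.
Proof.
move=> h0 h1 h2; apply/colP => i; rewrite -[i]inord_val.
by case: i => -[|[|[|m]]] //=.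
Qed.

Lemma coordB v w k : coord (v - w) k = coord v k - coord w k.
Proof. by rewrite /coord !mxE. Qed.

Lemma coordZ a v k : coord (a *: v) k = a * coord v k.
Proof. by rewrite /coord !mxE. Qed.

(** The linear map ([projX s], [projY s]) has kernel (s^2, -2s, 1), and its
    abscissa is the pairing with (1, s, s^2).  Neither curve has more than two
    points in a given plane through 0, so finitely many conditions, that the
    kernel avoid a plane or that the abscissa not vanish at a vector, exclude
    finitely many s only. *)
Definition projX (s : R) v := coord v 0 + s * coord v 1 + s ^+ 2 * coord v 2.
Definition projY (s : R) v := coord v 1 + 2 * s * coord v 2.

Definition quadratic (a b c : R) : {poly R} := a%:P + b *: 'X + c *: 'X^2.

Lemma quadratic_eq0 a b c : quadratic a b c = 0 -> [/\ a = 0, b = 0 & c = 0].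
Proof.
move=> q0; have co k : (quadratic a b c)`_k = 0 by rewrite q0 coef0.
move: (co 0) (co 1) (co 2); rewrite /quadratic !(coefD, coefC, coefZ, coefX, coefXn) /=.
by rewrite !(mulr0, mulr1, addr0, add0r).
Qed.

Lemma horner_quadratic a b c s :
  (quadratic a b c).[s] = a + b * s + c * s ^+ 2.
Proof. by rewrite /quadratic !hornerE. Qed.

Lemma proportional (a b : 'cV[R]_3) : a != 0 ->
    coord a 0 * coord b 1 = coord a 1 * coord b 0 ->
    coord a 0 * coord b 2 = coord a 2 * coord b 0 ->
    coord a 1 * coord b 2 = coord a 2 * coord b 1 ->
  exists c, b = c *: a.
Proof.
move=> a0 h01 h02 h12.
have [z0|n0] := eqVneq (coord a 0) 0; last first.
  exists (coord b 0 / coord a 0); apply: coord_eqP; rewrite coordZ; apply: (mulfI n0);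
    rewrite ?h01 ?h02; by field.
have [z1|n1] := eqVneq (coord a 1) 0; last first.
  exists (coord b 1 / coord a 1); apply: coord_eqP; rewrite coordZ; apply: (mulfI n1);
    rewrite -?h01 ?h12; by field.
have n2 : coord a 2 != 0.
  apply: contraNneq a0 => z2; apply/eqP/coord_eqP; by rewrite ?z0 ?z1 ?z2 /coord mxE.
exists (coord b 2 / coord a 2); apply: coord_eqP; rewrite coordZ; apply: (mulfI n2);
  rewrite -?h02 -?h12; by field.
Qed.

(** Two points with the same abscissa, or a collinear triple created by the
    projection, make s a root of a nonzero polynomial of degree at most 2. *)
Lemma generic_projection (T : finType) (u : T -> 'cV[R]_3) : injective u ->
  exists X Y : T -> R, injective X /\
    forall x y z, x != y ->
      (z \in line X Y x y) <-> exists c, u z - u x = c *: (u y - u x).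
Proof.
move=> u_inj.
pose p2 (q : T * T) := let a := u q.2 - u q.1 in
  quadratic (coord a 0) (coord a 1) (coord a 2).
(* The coefficients are the components of the cross product of a and b, paired
   with the direction (s^2, -2s, 1) of the kernel. *)
pose p3 (q : T * T * T) := let a := u q.1.2 - u q.1.1 in let b := u q.2 - u q.1.1 in
  quadratic (coord a 0 * coord b 1 - coord a 1 * coord b 0)
            (2 * (coord a 0 * coord b 2 - coord a 2 * coord b 0))
            (coord a 1 * coord b 2 - coord a 2 * coord b 1).
have [s sP] := common_nonroot (fun i : (T * T) + (T * T * T) =>
  match i with inl q => p2 q | inr q => p3 q end).
pose X x := projX s (u x); pose Y x := projY s (u x).
have X_inj : injective X.
  move=> x y XE; apply/eqP; have [//|ne] := eqVneq x y.
  have := sP (inl (x, y)); rewrite /= /root horner_quadratic /=.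
  have -> : p2 (x, y) != 0.
    apply/eqP => /quadratic_eq0 /= [h0 h1 h2]; move/eqP: ne; apply.
    apply: u_inj; apply/esym/eqP; rewrite -subr_eq0; apply/eqP.
    by apply: coord_eqP; rewrite ?h0 ?h1 ?h2 /coord mxE.
  move=> /(_ isT)/eqP; case; move: XE; rewrite /X /projX !coordB => XE; lra.
exists X, Y; split=> // x y z ne; rewrite (mem_line _ X_inj) //.
have detE : (Y z - Y x) * (X y - X x) - (Y y - Y x) * (X z - X x) = (p3 (x, y, z)).[s].
  by rewrite horner_quadratic /X /Y /projX /projY !coordB; ring.
rewrite -subr_eq0 detE; split=> [rt|[c cE]]; last first.
  by rewrite horner_quadratic /= cE !coordZ; apply/eqP; ring.
have : p3 (x, y, z) = 0.
  by apply/eqP; apply: contraTT rt => /(sP (inr (x, y, z))).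
move=> /quadratic_eq0 [/= h0 h1 h2].
by apply: proportional; [rewrite subr_eq0 eq_sym (inj_eq u_inj)|lra|lra|lra].
Qed.

End Projection.

(** * Additive energy as a number of quadruples *)

Section Energy.
Variable R : realType.
Variable X : {fset 'cV[R]_5}.

Definition quadruples : {set (X * X) * (X * X)} :=
  [set q | fsval q.1.1 - fsval q.1.2 == fsval q.2.1 - fsval q.2.2].

Lemma diff_reprE t :
  diff_repr X t = #|[set q : X * X | fsval q.1 - fsval q.2 == t]|.
Proof.
pose f (q : X * X) := (fsval q.1, fsval q.2).
have f_inj : injective f by move=> [a b] [c d] [/val_inj -> /val_inj ->].
rewrite /diff_repr.
have -> : [fset p in X `*` X | p.1 - p.2 == t]%fset
          = [fset f q | q in [set q : X * X | fsval q.1 - fsval q.2 == t]]%fset.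
  apply/fsetP => -[a b]; rewrite !inE /=; apply/andP/imfsetP => /=.
    move=> [/andP[aX bX] h]; exists ([` aX], [` bX])%fset => //=; by rewrite inE.
  by move=> [[x y]]; rewrite inE /= => h [-> ->]; rewrite !fsvalP.
by rewrite card_imfset //= -cardE.
Qed.

Lemma additive_energyE : additive_energy X = #|quadruples|.
Proof.
pose d (q : X * X) := fsval q.1 - fsval q.2.
pose D := [fset d q | q : X * X in predT]%fset.
have dD q : d q \in D by apply/imfsetP; exists q.
rewrite /additive_energy (fsbigTE D) => [|t tD]; last first.
  rewrite diff_reprE (_ : [set q : X * X | _] = finset.set0) ?cards0 //.
  apply/setP => q; rewrite !inE; apply: contraNF tD => /eqP <-; exact: dD.
transitivity (\sum_(q : X * X) diff_repr X (d q))%N; last first.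
  rewrite -[RHS]sum1_card (eq_bigl (fun q => d q.1 == d q.2)); last first.
    by move=> q; rewrite inE.
  rewrite -(pair_big_dep predT (fun a b => d a == d b) (fun _ _ => 1%N)) /=.
  apply: eq_bigr => q _; rewrite diff_reprE -sum1_card; apply: eq_bigl => q'.
  by rewrite inE eq_sym.
transitivity (\sum_(t <- D) \sum_(q : X * X | d q == t) diff_repr X t)%N.
  apply: eq_bigr => t _; rewrite sum_nat_const -mulnn; congr muln.
  by rewrite [LHS]diff_reprE; apply: eq_card => q; rewrite inE.
rewrite (exchange_big_dep predT) //=; apply: eq_bigr => q _.
rewrite big_mkcond (bigD1_seq (d q)) ?dD ?fset_uniq //= eqxx big1 ?addn0 // => t.
by rewrite eq_sym => /negPf ->.
Qed.

(** The solutions of the form x - x = z - z. *)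
Lemma energy_ge : (#|` X| ^ 2 <= additive_energy X)%N.
Proof.
rewrite additive_energyE cardfE -mulnn -card_prod -cardsT.
have inj : injective (fun p : X * X => ((p.1, p.1), (p.2, p.2))).
  by move=> [a b] [c d] [-> _ -> _].
rewrite -(card_imset _ inj); apply/subset_leq_card/fintype.subsetP => _ /imsetP[p _ ->].
by rewrite inE /= !subrr.
Qed.

End Energy.

(** * The energy of subsets of the surface *)

Section EnergyBound.
Variables (R : realType) (A1 A2 : 'M[R]_3).
Hypothesis (A1sym : A1^T = A1) (A2sym : A2^T = A2).
Hypothesis A1pos : forall u : 'cV[R]_3, u != 0 -> 0 < qform A1 u.
Variable v : 'I_3 -> 'cV[R]_3.
Hypothesis eigenlines : forall mu t,
  A2 *m t = mu *: (A1 *m t) -> exists i c, t = c *: v i.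
Variable X : {fset 'cV[R]_5}.
Hypothesis X_sub : ([set` X] `<=` Sigma A1 A2)%classic.
Implicit Types (x y z w : X).

Definition base_point (p : 'cV[R]_5) : 'cV[R]_3 := @usubmx R 3 (1 + 1) 1 p.

Lemma base_point_graph u : base_point (graph_point A1 A2 u) = u.
Proof. exact: col_mxKu. Qed.

Lemma base_pointB p p' : base_point (p - p') = base_point p - base_point p'.
Proof. by apply/colP => i; rewrite !mxE. Qed.

Lemma point_on_graph x : fsval x = graph_point A1 A2 (base_point (fsval x)).
Proof. by have [u _ <-] := X_sub (fsvalP x); rewrite base_point_graph. Qed.

Local Notation pt x := (base_point (fsval x)).

Lemma pt_inj : injective (fun x => pt x).
Proof. by move=> x y h; apply: val_inj; rewrite /= point_on_graph h -point_on_graph. Qed.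

(** The last two coordinates are additive functions on R^5. *)
Lemma graph_point_relation u1 u2 u3 u4 :
    graph_point A1 A2 u1 - graph_point A1 A2 u2
      = graph_point A1 A2 u3 - graph_point A1 A2 u4 ->
  [/\ u1 - u2 = u3 - u4,
      qform A1 u1 - qform A1 u2 = qform A1 u3 - qform A1 u4
    & qform A2 u1 - qform A2 u2 = qform A2 u3 - qform A2 u4].
Proof.
move=> h; pose low p := @dsubmx R 3 (1 + 1) 1 p.
pose c1 p := @usubmx R 1 1 1 (low p) 0 0; pose c2 p := @dsubmx R 1 1 1 (low p) 0 0.
have g1 u : c1 (graph_point A1 A2 u) = qform A1 u.
  by rewrite /c1 /low /graph_point col_mxKd col_mxKu mxE mulr1n.
have g2 u : c2 (graph_point A1 A2 u) = qform A2 u.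
  by rewrite /c2 /low /graph_point col_mxKd col_mxKd mxE mulr1n.
have c1B p p' : c1 (p - p') = c1 p - c1 p' by rewrite /c1 /low !mxE.
have c2B p p' : c2 (p - p') = c2 p - c2 p' by rewrite /c2 /low !mxE.
split; first by have := congr1 base_point h; rewrite !base_pointB !base_point_graph.
  by have := congr1 c1 h; rewrite !c1B !g1.
by have := congr1 c2 h; rewrite !c2B !g2.
Qed.

Local Notation side1 q := (pt q.1.2 - pt q.1.1).
Local Notation side2 q := (pt q.2.1 - pt q.1.1).
Local Notation biorth := (biorth A1 A2).
Local Notation on_axis := (on_axis v).

Lemma quadruple_pt (q : (X * X) * (X * X)) : q \in quadruples X ->
  pt q.1.1 - pt q.1.2 = pt q.2.1 - pt q.2.2 /\ biorth (side1 q) (side2 q).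
Proof.
case: q => -[x y] [z w]; rewrite inE /= => /eqP.
rewrite (point_on_graph x) (point_on_graph y) (point_on_graph z) (point_on_graph w).
rewrite !base_point_graph => /graph_point_relation[h h1 h2].
split=> //; split.
  by have := qform_parallelogram A1sym h;
    rewrite h1 subrr => /esym/eqP; rewrite mulf_eq0 pnatr_eq0 => /eqP.
by have := qform_parallelogram A2sym h;
    rewrite h2 subrr => /esym/eqP; rewrite mulf_eq0 pnatr_eq0 => /eqP.
Qed.

Lemma quadruple_eq (q q' : (X * X) * (X * X)) :
    q \in quadruples X -> q' \in quadruples X ->
  q.1.1 = q'.1.1 -> q.1.2 = q'.1.2 -> q.2.1 = q'.2.1 -> q = q'.
Proof.
move=> /quadruple_pt[h _] /quadruple_pt[h' _].
case: q q' h h' => -[x y] [z w] [[x' y'] [z' w']] /= h h' ex ey ez; subst x' y' z'.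
congr (_, (_, _)); apply: pt_inj; apply: oppr_inj; apply: (addrI (pt z)).
by rewrite -h -h'.
Qed.

Lemma quadruple_diagonal (q : (X * X) * (X * X)) : q \in quadruples X ->
  side1 q + side2 q = pt q.2.2 - pt q.1.1.
Proof.
move=> /quadruple_pt[h _]; have -> : pt q.2.2 = pt q.2.1 - (pt q.1.1 - pt q.1.2).
  by rewrite h opprB addrC subrK.
by apply/colP => i; rewrite !mxE; ring.
Qed.

(** The quadruple is recovered from the opposite vertices x, w and the axis of
    the first side; the value [None] stands for a first side equal to 0, which
    lies on all three axes. *)
Lemma card_quadruples_on_axis_fst :
  (#|[set q in quadruples X | `[< on_axis (side1 q) >]]| <= 4 * #|` X| ^ 2)%N.
Proof.
pose r (q : (X * X) * (X * X)) (p : option 'I_3 * (X * X)) :=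
  (p.2 == (q.1.1, q.2.2)) &&
  match p.1 with
  | None => side1 q == 0
  | Some i => (side1 q != 0) && `[< exists c, side1 q = c *: v i >]
  end.
have -> : (4 * #|` X| ^ 2 = #|[set: option 'I_3 * (X * X)]|)%N.
  by rewrite cardsT !card_prod card_option card_ord cardfE mulnn.
apply: (card_le_rel (r := r)).
  move=> q; rewrite inE => /andP[qQ /asboolP[i ic]].
  have [s0|s0] := eqVneq (side1 q) 0.
    by exists (None, (q.1.1, q.2.2)); rewrite ?inE // /r /= s0 !eqxx.
  exists (Some i, (q.1.1, q.2.2)); rewrite ?inE // /r /= s0 !eqxx /=.
  exact/asboolP.
move=> q q' [k p] /finset.setIdP[qQ _] /finset.setIdP[q'Q _] /andP[/= /eqP pE o1].
move=> /andP[/= /eqP pE' o2]; move: pE'; rewrite pE => -[e11 e22].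
have sE : side1 q = side1 q'.
  case: k o1 o2 => [i|/eqP -> /eqP -> //] /andP[t0 /asboolP[c cE]] /andP[t0' /asboolP[c' cE']].
  have [_ b] := quadruple_pt qQ; have [_ b'] := quadruple_pt q'Q.
  apply: (axis_component_unique A1pos cE cE' t0 t0' b b').
  by rewrite !quadruple_diagonal // e11 e22.
have e12 : q.1.2 = q'.1.2 by apply: pt_inj; apply: (addIr (- pt q.1.1)); rewrite sE e11.
apply: quadruple_eq => //; apply: pt_inj.
have [h _] := quadruple_pt qQ; have [h' _] := quadruple_pt q'Q.
by apply: (addIr (- pt q.2.2)); rewrite /= -h e11 e12 h' e22.
Qed.

(** The equation x - y = z - w is also x - z = y - w, which exchanges the two
    sides. *)
Lemma card_quadruples_on_axis_snd :
  (#|[set q in quadruples X | `[< on_axis (side2 q) >]]| <= 4 * #|` X| ^ 2)%N.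
Proof.
apply: leq_trans card_quadruples_on_axis_fst.
pose f (q : (X * X) * (X * X)) := ((q.1.1, q.2.1), (q.1.2, q.2.2)).
have f_inj : injective f by move=> [[a b] [c d]] [[a' b'] [c' d']] [-> -> -> ->].
rewrite -(card_imset _ f_inj); apply/subset_leq_card/fintype.subsetP.
move=> q' /imsetP[q]; rewrite !inE => /andP[/eqP h ax] ->; rewrite /f /= ax andbT.
rewrite -subr_eq0; apply/eqP.
have -> : fsval q.2.2 = fsval q.2.1 - (fsval q.1.1 - fsval q.1.2).
  by rewrite h opprB addrC subrK.
by apply/colP => i; rewrite !mxE; ring.
Qed.

Definition generic_corner x y z : bool :=
  `[< [/\ biorth (pt y - pt x) (pt z - pt x),
          ~ on_axis (pt y - pt x) & ~ on_axis (pt z - pt x)] >].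

Lemma off_axis_neq x y : ~ on_axis (pt y - pt x) -> x != y.
Proof.
by move=> no; apply/eqP => xy; apply: no; exists ord0, 0; rewrite xy subrr scale0r.
Qed.

Lemma off_axis_neq0 t : ~ on_axis t -> t != 0.
Proof. by move=> no; apply/eqP => t0; apply: no; exists ord0, 0; rewrite t0 scale0r. Qed.

(** After a generic projection, lines in the plane correspond to lines in R^3, and
    the geometric hypotheses on corners become linear algebra. *)
Lemma card_generic_corners :
  (#|[set t : X * X * X | generic_corner t.1.1 t.1.2 t.2]|
     <= (4 + 16 * 4096) * #|` X| ^ 2 * (trunc_log 2 #|` X|).+1)%N.
Proof.
have [PX [PY [PX_inj lineP]]] := generic_projection pt_inj.
rewrite cardfE; apply: (card_corners PX_inj (Y := PY)).
- by move=> x y z /asboolP[_ n1 n2]; split; apply: off_axis_neq.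
- move=> x y z /asboolP[b n1 n2]; apply/asboolP; split=> //.
  exact: biorthC.
- move=> x y z z' /asboolP[b n1 n2] /asboolP[b' _ _].
  apply/lineP; first exact: off_axis_neq.
  exact: (biorth_line A1sym A2sym A1pos eigenlines n1 (off_axis_neq0 n2) b b').
move=> l x x' y y' z ll xl yl x'l y'l /asboolP[b n1 n2] /asboolP[b' n1' n2'].
have ne := off_axis_neq n1.
(* Both feet lie on l, which in R^3 is the line through x with direction t. *)
have lE := is_lineP PX_inj ll xl yl ne.
rewrite lE in x'l y'l.
have /(lineP _ _ _ ne)[c cE] := x'l; have /(lineP _ _ _ ne)[e eE] := y'l.
have t'E : pt y' - pt x' = (e - c) *: (pt y - pt x).
  by rewrite scalerBl -cE -eE; apply/colP => i; rewrite !mxE; ring.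
have ec : e - c != 0.
  by apply: contraNneq (off_axis_neq0 n1') => ec; rewrite t'E ec scale0r.
have dE : pt z - pt x = c *: (pt y - pt x) + (pt z - pt x').
  by rewrite -cE; apply/colP => i; rewrite !mxE; ring.
rewrite t'E in b'.
have c0 := biorth_foot A1pos (off_axis_neq0 n1) ec b b' dE.
by apply/esym/pt_inj/eqP; rewrite -subr_eq0 cE c0 scale0r.
Qed.

Lemma energy_le_log :
  (additive_energy X <= (12 + 16 * 4096) * #|` X| ^ 2 * (trunc_log 2 #|` X|).+1)%N.
Proof.
rewrite additive_energyE.
pose Q1 := [set q in quadruples X | `[< on_axis (side1 q) >]].
pose Q2 := [set q in quadruples X | `[< on_axis (side2 q) >]].
pose Q3 := quadruples X :\: (Q1 :|: Q2).
have le3 : (#|Q3| <= (4 + 16 * 4096) * #|` X| ^ 2 * (trunc_log 2 #|` X|).+1)%N.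
  apply: leq_trans card_generic_corners.
  apply: (card_le_rel (r := fun q t => t == (q.1.1, q.1.2, q.2.1))) => [q|q q' t].
    rewrite !inE => /andP[no qQ]; exists (q.1.1, q.1.2, q.2.1) => //; rewrite inE.
    have qQ' : q \in quadruples X by rewrite inE.
    move: no; rewrite qQ /= negb_or => /andP[/asboolPn n1 /asboolPn n2].
    by apply/asboolP; split=> //; have [] := quadruple_pt qQ'.
  move=> /finset.setDP[qQ _] /finset.setDP[q'Q _] /eqP -> /eqP[e1 e2 e3].
  exact: quadruple_eq.
have -> : quadruples X = Q1 :|: Q2 :|: Q3.
  apply/setP => q; rewrite !inE; case: (_ == _) => //=; rewrite !andbT.
  by case: `[< _ >] => //; case: `[< _ >].
apply: leq_trans (leq_card_setU _ _) _.
apply: leq_trans (leq_add (leq_card_setU _ _) le3) _.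
apply: leq_trans (leq_add
  (leq_add card_quadruples_on_axis_fst card_quadruples_on_axis_snd) (leqnn _)) _.
move: (#|` X| ^ 2)%N (trunc_log 2 #|` X|) (16 * 4096)%N => n2 J K; nia.
Qed.

End EnergyBound.

(** * Powers against logarithms, and the theorem *)

Section Powers.
Variable R : realType.

(** From exp x >= 1 + x. *)
Lemma powR_log_lower (eps : R) (m n : nat) : 0 <= eps -> (2 ^ m <= n)%N ->
  1 + eps * (m%:R * ln 2) <= n%:R `^ eps.
Proof.
move=> eps0 mn; have n0 : (0 < n)%N by apply: leq_trans mn; rewrite expn_gt0.
rewrite /powR pnatr_eq0 (gtn_eqF n0); apply: le_trans (expR_ge1Dx _).
rewrite lerD2l ler_wpM2l // mulr_natl -lnXn // ler_ln ?posrE ?exprn_gt0 ?ltr0n //.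
by rewrite -natrX ler_nat.
Qed.

Lemma ln2_gt0 : 0 < ln 2 :> R.
Proof. by rewrite ln_gt0 // ltr1n. Qed.

Lemma log_factor_absorbed (eps : R) (n : nat) : 0 < eps -> (0 < n)%N ->
  (trunc_log 2 n).+1%:R <= (1 + (eps * ln 2)^-1) * n%:R `^ eps.
Proof.
move=> eps0 n0; have /andP[le _] := trunc_log_bounds (isT : (1 < 2)%N) n0.
set J := trunc_log 2 n in le *.
have low := powR_log_lower (ltW eps0) le.
have k0 : 0 < eps * ln 2 by rewrite mulr_gt0 // ln2_gt0.
have c0 : 0 <= 1 + (eps * ln 2)^-1 by rewrite addr_ge0 // invr_ge0 ltW.
apply: le_trans (ler_wpM2l c0 low).
have -> : (1 + (eps * ln 2)^-1) * (1 + eps * (J%:R * ln 2)) =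
          J.+1%:R + (eps * ln 2) * J%:R + (eps * ln 2)^-1.
  rewrite -natr1; field; apply/andP; split; by rewrite gt_eqF // ln2_gt0.
by rewrite -addrA lerDl addr_ge0 ?invr_ge0 ?(ltW k0) // mulr_ge0 // ltW.
Qed.

End Powers.

Section Sharpness.
Variables (R : realType) (A1 A2 : 'M[R]_3).

(** The surface is a graph over R^3. *)
Lemma Sigma_infinite (n : nat) :
  exists X : {fset 'cV[R]_5}, ([set` X] `<=` Sigma A1 A2)%classic /\ #|` X| = n.
Proof.
pose f (k : nat) := graph_point A1 A2 (const_mx k%:R).
have f_inj : injective f.
  move=> i j /(congr1 (@base_point R)); rewrite !base_point_graph => /colP/(_ ord0).
  by rewrite !mxE => /eqP; rewrite eqr_nat => /eqP.
exists [fset f (val i) | i : 'I_n in predT]%fset; split.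
  by move=> p /= /imfsetP[i _ ->]; exists (const_mx i%:R).
by rewrite card_imfset => [|i j /f_inj/val_inj //]; rewrite -cardE card_ord.
Qed.

End Sharpness.

Lemma energy_bound_uniform (R : realType) :
  exists K : nat, forall A1 A2 : 'M[R]_3,
    A1^T = A1 -> A2^T = A2 -> simple_generalized_spectrum A1 A2 ->
    forall X : {fset 'cV[R]_5}, ([set` X] `<=` Sigma A1 A2)%classic ->
      (additive_energy X <= K * #|` X| ^ 2 * (trunc_log 2 #|` X|).+1)%N.
Proof.
exists (12 + 16 * 4096)%N => A1 A2 A1s A2s sp X XS.
have [v eigenlines] := generalized_eigenlines A1s A2s sp.
by have [[_ A1pos] _] := sp; exact: (energy_le_log A1s A2s A1pos eigenlines XS).
Qed.

Local Open Scope classical_set_scope.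

Theorem theorem1p2 (R : realType) :
  (forall eps : R, 0 < eps ->
     exists C : R, forall A1 A2 : 'M[R]_3,
       A1^T = A1 -> A2^T = A2 -> simple_generalized_spectrum A1 A2 ->
       forall X : {fset 'cV[R]_5}, [set` X] `<=` Sigma A1 A2 ->
         (additive_energy X)%:R <= C * (#|` X|%:R `^ (2 + eps))) /\
  (forall A1 A2 : 'M[R]_3,
     A1^T = A1 -> A2^T = A2 -> simple_generalized_spectrum A1 A2 ->
     forall b : R, b < 2 ->
       ~ exists C : R, forall X : {fset 'cV[R]_5},
           [set` X] `<=` Sigma A1 A2 ->
           (additive_energy X)%:R <= C * (#|` X|%:R `^ b)).
Proof.
split=> [eps eps0|A1 A2 _ _ _ b b2 [C bound]].
  have [K energy_le] := energy_bound_uniform R.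
  exists (K%:R * (1 + (eps * ln 2)^-1)) => A1 A2 A1s A2s sp X XS.
  have := energy_le A1 A2 A1s A2s sp X XS.
  rewrite -(ler_nat R) => /le_trans; apply.
  have [->|n0] := posnP #|` X|.
    by rewrite muln0 mul0n powR0 ?mulr0 // gt_eqF // addr_gt0.
  rewrite powRD; last by rewrite pnatr_eq0 -lt0n n0 implybT.
  rewrite powR_mulrn // 2!natrM natrX.
  have := exprn_ge0 2 (ler0n R #|` X|); move: (_ ^+ 2) => N2 N2_ge0.
  rewrite -!mulrA ler_wpM2l // mulrCA ler_wpM2l //.
  exact: log_factor_absorbed.
have d0 : 0 < 2 - b by rewrite subr_gt0.
(* For N = 2^m, N^(2 - b) >= 1 + (2 - b) m log 2, which exceeds C for this m. *)
pose m := Num.bound `|C / ((2 - b) * ln 2)|.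
have [X [XS Xn]] := Sigma_infinite A1 A2 (2 ^ m).
have := bound X XS; rewrite Xn; set N := (2 ^ m)%N.
have N0 : 0 < N%:R :> R by rewrite ltr0n expn_gt0.
have : N%:R ^+ 2 <= (additive_energy X)%:R :> R.
  by rewrite -natrX ler_nat /N -Xn energy_ge.
move=> /le_trans h /h {h}.
have -> : N%:R ^+ 2 = N%:R `^ (2 - b) * N%:R `^ b :> R.
  rewrite -powRD; last by rewrite (lt0r_neq0 N0) implybT.
  by rewrite subrK powR_mulrn // ltW.
rewrite ler_pM2r ?powR_gt0 //; apply/negP; rewrite -ltNge.
apply: lt_le_trans (powR_log_lower (ltW d0) (leqnn _)).
have k0 : 0 < (2 - b) * ln 2 :> R by rewrite mulr_gt0 // ln2_gt0.
have : C / ((2 - b) * ln 2) < m%:R.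
  exact: le_lt_trans (ler_norm _) (archi_boundP (normr_ge0 _)).
rewrite ltr_pdivrMr // => /lt_trans; apply.
by rewrite mulrCA ltrDr.
Qed.
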